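(* Let $D_{in}$ be an arbitrary positive integer, let $\rho:\mathbb{R}\to\mathbb{R}$ be a piecewise $C^1$ function with $\rho'\in BV(\mathbb{R})$, and let $\epsilon>0$. Then there exists a meromorphic function $\sigma:\mathcal{D}\to\mathbb{C}$, defined on an open set $\mathcal{D}\subset\mathbb{C}$ with $\mathcal{D}\supset\mathbb{R}$, with $\sigma(\mathbb{R})\subset\mathbb{R}$ and $\|\rho-\sigma\|_{L^\infty(\mathbb{R})}<\epsilon$, with the following property: whenever $\mathcal{N}_1,\dots,\mathcal{N}_n$ are pairwise non-isomorphic (with respect to $\simeq$) neural networks in $\mathscr{N}^{D_{in},1}_{nc}$, the set $\{\mathcal{N}_j^\sigma\}_{j=1}^n\cup\{\mathbf{1}\}$ is a linearly independent set of functions $\mathbb{R}^{D_{in}}\to\mathbb{R}$, where $\mathbf{1}$ is the constant function with value $1$.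
   Context: $BV(\mathbb{R})=\{f\in L^1(\mathbb{R}): \sup\{\int_\mathbb{R} f\varphi'\,dx : \varphi\in C^1_c(\mathbb{R}),\ \|\varphi\|_{L^\infty}\le 1\}<\infty\}$. A neural network is a tuple $\mathcal{N}=(D_0,D_1,\dots,D_L;W^1,\theta^1,\dots,W^L,\theta^L)$ where $L\ge1$ is an integer, $D_0,\dots,D_L$ are positive integers (the layout), $W^\ell\in\mathbb{R}^{D_\ell\times D_{\ell-1}}$ and $\theta^\ell\in\mathbb{R}^{D_\ell}$, and no $W^\ell$ has an identically zero row or an identically zero column. For a nonlinearity $\rho:\mathbb{R}\to\mathbb{R}$ the map realized by $\mathcal{N}$ is $\mathcal{N}^\rho:\mathbb{R}^{D_0}\to\mathbb{R}^{D_L}$, $\mathcal{N}^\rho(x)=\rho(W^L(\rho(W^{L-1}(\cdots\rho(W^1x+\theta^1)\cdots)+\theta^{L-1}))+\theta^L)$, with $\rho$ acting componentwise (here $\sigma$ acts via its restriction to $\mathbb{R}$). $\mathscr{N}^{D_{in},1}_{nc}$ is the set of all neural networks with $D_0=D_{in}$, $D_L=1$ (depth and other layout entries arbitrary) that satisfy the no-clones condition: there are no $\ell$ and $j\neq j'$ with $(\theta^\ell_j,W^\ell_{j1},\dots,W^\ell_{jD_{\ell-1}})=(\theta^\ell_{j'},W^\ell_{j'1},\dots,W^\ell_{j'D_{\ell-1}})$. $\mathcal{N}\simeq\widetilde{\mathcal{N}}$ means: $L=\widetilde L$, same layout, and there are permutations $\gamma_\ell$ of $\{1,\dots,D_\ell\}$,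 with $\gamma_0,\gamma_L$ the identity, such that $\widetilde W^\ell_{jk}=W^\ell_{\gamma_\ell(j)\gamma_{\ell-1}(k)}$ and $\widetilde\theta^\ell_j=\theta^\ell_{\gamma_\ell(j)}$ for all $\ell,j,k$. *)

(* Defs.v *)
From HB Require Import structures.
From mathcomp Require Import all_boot all_order all_fingroup all_algebra.
From mathcomp Require Import all_classical all_reals all_analysis.
From mathcomp Require Import complex.

Set Implicit Arguments.
Unset Strict Implicit.
Unset Printing Implicit Defensive.
Import Order.TTheory GRing.Theory Num.Theory.
Import numFieldNormedType.Exports.

Local Open Scope ring_scope.
Local Open Scope classical_set_scope.
Local Open Scope complex_scope.

(* The breakpoints are locally finite, [f] is continuous across them, and the
   derivative has finite one-sided limits there; by the mean value theorem this
   says that [f] is C^1 on each closed piece. *)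
Definition piecewise_C1 (R : realType) (f : R -> R) : Prop :=
  continuous f /\
  exists S : set R,
    [/\ forall a b : R, finite_set (S `&` `[a, b]),
        forall x, ~ S x -> derivable f x 1 /\ {for x, continuous f^`()} &
        forall s, S s ->
          cvg (f^`() x @[x --> s^'-]) /\ cvg (f^`() x @[x --> s^'+])].

Definition C1c (R : realType) (phi : R -> R) : Prop :=
  [/\ forall x, derivable phi x 1, continuous phi^`() &
      compact (closure [set x | phi x != 0])].

Definition norm_Linfty (R : realType) (f : R -> R) : \bar R :=
  Lnorm (@lebesgue_measure R) +oo%E (EFin \o f).

(* Invariant under modification of [f] on a null set, so that it may be applied
   to a derivative which exists only outside a null set. *)
Definition BV_line (R : realType) (f : R -> R) : Prop :=
  (@lebesgue_measure R).-integrable setT (EFin \o f) /\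
  (ereal_sup [set (\int[@lebesgue_measure R]_x (f x * derive1 phi x)%:E)%E
             | phi in [set phi : R -> R | C1c phi /\ (norm_Linfty phi <= 1)%E]]
   < +oo)%E.

(* [R[i]^o] is [R[i]] as a normed space over itself: its topology is that of the
   modulus, and [derivable f z 1] over it is complex differentiability at [z]. *)
Definition holomorphic_at (R : realType) (f : R[i]^o -> R[i]^o) (z : R[i]^o) :
    Prop :=
  \forall w \near z, derivable f w 1.

Definition pole (R : realType) (f : R[i]^o -> R[i]^o) (p : R[i]^o) : Prop :=
  exists (m : nat) (g : R[i]^o -> R[i]^o),
    [/\ (0 < m)%N, holomorphic_at g p, g p != 0 &
        \forall z \near p^', f z = g z / (z - p) ^+ m].

(* [f] is meromorphic on [D] with set of poles [P]; the values of the total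
   function [f] at the poles and outside [D] are irrelevant. *)
Definition meromorphic (R : realType) (D P : set R[i]^o)
    (f : R[i]^o -> R[i]^o) : Prop :=
  [/\ open D, P `<=` D,
      forall z, D z -> ~ limit_point P z,
      forall z, D z -> ~ P z -> holomorphic_at f z &
      forall p, P p -> pole f p].

(* [weight l] and [bias l] are W^(l+1) and theta^(l+1), for l = 0, ..., L - 1
   with L = (size layout).-1; for l >= L they have no rows, so they carry no
   spurious data. *)
Record network (R : realType) := Network {
  layout : seq nat;
  weight : forall l : nat, 'M[R]_(nth 0%N layout l.+1, nth 0%N layout l);
  bias : forall l : nat, 'cV[R]_(nth 0%N layout l.+1);
  depth_ge1 : (1 <= (size layout).-1)%N;
  layout_gt0 : forall d, d \in layout -> (0 < d)%N;
  weight_row_neq0 : forall l j, (l < (size layout).-1)%N ->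
    row j (weight l) != 0;
  weight_col_neq0 : forall l k, (l < (size layout).-1)%N ->
    col k (weight l) != 0
}.

Definition depth (R : realType) (N : network R) : nat := (size (layout N)).-1.

Definition width (R : realType) (N : network R) (l : nat) : nat :=
  nth 0%N (layout N) l.

Fixpoint layer_output (R : realType) (rho : R -> R) (N : network R)
    (x : 'cV[R]_(width N 0)) (l : nat) : 'cV[R]_(width N l) :=
  match l return 'cV[R]_(width N l) with
  | 0%N => x
  | k.+1 => map_mx rho (weight N k *m layer_output rho x k + bias N k)
  end.

Definition realization (R : realType) (rho : R -> R) (N : network R)
    (x : 'cV[R]_(width N 0)) : 'cV[R]_(width N (depth N)) :=
  layer_output rho x (depth N).

Definition no_clones (R : realType) (N : network R) : Prop :=
  forall (l : nat) (j j' : 'I_(width N l.+1)), (l < depth N)%N -> j != j' ->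
    (bias N l j 0, row j (weight N l)) <> (bias N l j' 0, row j' (weight N l)).

Record nc_network (R : realType) (Din : nat) := NcNetwork {
  nc_net :> network R;
  width_in : width nc_net 0 = Din;
  width_out : width nc_net (depth nc_net) = 1%N;
  nc_no_clones : no_clones nc_net
}.

Definition nc_realization (R : realType) (Din : nat) (rho : R -> R)
    (N : nc_network R Din) (x : 'cV[R]_Din) : R :=
  castmx (width_out N, erefl 1%N)
    (realization rho (castmx (esym (width_in N), erefl 1%N) x)) 0 0.

Definition isomorphic (R : realType) (N N' : network R) : Prop :=
  exists (eqD : layout N = layout N') (gamma : forall l, {perm 'I_(width N l)}),
    let cast l : 'I_(width N l) -> 'I_(width N' l) :=
      cast_ord (congr1 (fun D => nth 0%N D l) eqD) in
    [/\ gamma 0%N = 1%g, gamma (depth N) = 1%g &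
        forall l, (l < depth N)%N -> forall j : 'I_(width N l.+1),
          bias N' l (cast l.+1 j) 0 = bias N l (gamma l.+1 j) 0 /\
          forall k : 'I_(width N l),
            weight N' l (cast l.+1 j) (cast l k) =
            weight N l (gamma l.+1 j) (gamma l k)].

Definition linearly_independent (K : fieldType) (V : lmodType K) (I : finType)
    (f : I -> V) : Prop :=
  forall c : I -> K, \sum_i c i *: f i = 0 -> forall i, c i = 0.

Definition with_one (R : realType) (Din n : nat)
    (f : 'I_n -> 'cV[R]_Din -> R^o) (o : option 'I_n) : 'cV[R]_Din -> R^o :=
  if o is Some j then f j else fun=> 1.

(* Main.v *)
Require Import Defs.
From HB Require Import structures.
From mathcomp Require Import all_boot all_order all_fingroup all_algebra.
From mathcomp Require Import all_classical all_reals all_analysis.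
From mathcomp Require Import complex measurable_realfun ess_sup_inf ring lra.

Set Implicit Arguments.
Unset Strict Implicit.
Unset Printing Implicit Defensive.
Import Order.TTheory GRing.Theory Num.Theory.
Import numFieldNormedType.Exports.

Local Open Scope ring_scope.
Local Open Scope classical_set_scope.
Local Open Scope complex_scope.

(** [sigma] is chosen without poles: holomorphic on a strip around the real line
and generic in the following sense. A finite system of equations
[y_q = sigma (a_q)], where the [a_q] are pairwise distinct and the [a_q], [y_q]
are given polynomial functions of fewer real parameters than there are equations,
has no solution. Each such system with rational coefficients, restricted to a
cube of parameters on which the [a_q] are separated, is destroyed with a positive
margin by an arbitrarily small perturbation [sum_j v_j z^j / (1 + z^2)^n]: by
interpolation a parameter determines [v] up to a small error, and there are more
grid values of [v] than cells of parameters. Countably many perturbations of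
rapidly decreasing size, added to a sum of smoothed steps
[(z - t) / sqrt (d^2 + (z - t)^2)] approximating [rho], give [sigma].

A linear relation between 1, the coordinates and the [sigma \o b] for distinct
nonconstant preactivations [b], on some open set, contradicts genericity: at [M]
rational sample points it gives [M] equations more than there are unknown unit
values, and [M] may exceed the number of weights. Openness lets the induction
along the units produce sample points at which all preactivations differ.
Hence a preactivation determines its bias, its weights and the preactivations of
the previous layer, so equal outputs force isomorphic networks. *)

(** * Interpolation and pigeonhole *)

(** Newton interpolation: dividing [p - p(a 0)] by [X - a 0] leaves a polynomial of smaller size
    whose values at the other nodes are divided differences, hence at most [2 / l * e]. The constant
    sees the nodes only through [A] and [l], so it serves all parameters of a cube at once. *)
Lemma interpolation_bound (R : realFieldType) (n : nat) (A l : R) :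
  0 <= A -> 0 < l ->
  exists2 C : R, 0 <= C & forall (a : nat -> R) (p : {poly R}) (e : R),
    (size p <= n)%N ->
    (forall k, (k < n)%N -> `|a k| <= A) ->
    (forall k k', (k < k')%N -> (k' < n)%N -> l <= `|a k' - a k|) ->
    (forall k, (k < n)%N -> `|p.[a k]| <= e) -> forall j, `|p`_j| <= C * e.
Proof.
move=> A0 l0; elim: n => [|n [C C0 IH]].
  exists 0 => // a p e; rewrite leqn0 size_poly_eq0 => /eqP -> _ _ _ j.
  by rewrite coef0 normr0 mul0r.
exists (1 + (1 + A) * C * (2 / l)).
  by rewrite addr_ge0 // !mulr_ge0 ?addr_ge0 ?invr_ge0 // ltW.
move=> a p e sp aA al pe j.
have e0 : 0 <= e by apply: le_trans (normr_ge0 _) (pe 0%N _).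
have /factor_theorem[q pq] : root (p - (p.[a 0%N])%:P) (a 0%N).
  by rewrite /root !hornerE subrr.
have sq : (size q <= n)%N.
  have [->|q0] := eqVneq q 0; first by rewrite size_poly0.
  rewrite -ltnS.
  have <- : size (q * ('X - (a 0%N)%:P)) = (size q).+1.
    by rewrite size_Mmonic ?monicXsubC // size_XsubC addn2.
  rewrite -pq.
  rewrite (leq_trans (size_polyD _ _)) // size_polyN geq_max sp.
  by rewrite (leq_trans (size_polyC_leq1 _)).
have qe k : (k < n)%N -> `|q.[a k.+1]| <= 2 / l * e.
  move=> kn; have := al 0%N k.+1 isT kn => lk.
  have -> : q.[a k.+1] = (p.[a k.+1] - p.[a 0%N]) / (a k.+1 - a 0%N).
    have -> : p.[a k.+1] - p.[a 0%N] = (p - (p.[a 0%N])%:P).[a k.+1].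
      by rewrite !hornerE.
    rewrite pq !hornerE mulfK // -normr_gt0.
    exact: lt_le_trans lk.
  rewrite normrM normfV mulrAC ler_pM ?invr_ge0 //.
    rewrite (le_trans (ler_normB _ _)) //.
    by rewrite mulrDl mul1r lerD ?pe.
  by rewrite lef_pV2 // posrE // (lt_le_trans l0).
have qj i : `|q`_i| <= C * (2 / l * e).
  apply: (IH (fun k => a k.+1)) => //.
  - by move=> k kn; exact: aA.
  - by move=> k k' kk' k'n; exact: al.
have -> : p = q * ('X - (a 0%N)%:P) + (p.[a 0%N])%:P by rewrite -pq subrK.
have cj : `|((p.[a 0%N])%:P)`_j| <= e.
  by rewrite coefC; case: eqP => _; rewrite ?normr0 // pe.
have qXj : `|(q * 'X)`_j| <= C * (2 / l * e).
  rewrite coefMX; case: eqP => _; last exact: qj.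
  by rewrite normr0 !mulr_ge0 ?invr_ge0 // ltW.
have qaj : `|(q * (a 0%N)%:P)`_j| <= A * (C * (2 / l * e)).
  by rewrite coefMC normrM mulrC ler_pM // aA.
rewrite mulrBr coefD coefB (le_trans (ler_normD _ _)) //.
rewrite (le_trans (lerD (ler_normB _ _) (lexx _))) //.
apply: (le_trans (lerD (lerD qXj qaj) cj)).
by rewrite le_eqVlt; apply/orP; left; apply/eqP; ring.
Qed.

(** Damped monomials: for [j <= n] they are bounded with bounded derivative on a strip around the
    real line, yet interpolation with them reduces to polynomials. The field is arbitrary so that
    one formula serves [R] and [R[i]]. *)
Definition rat_basis (R : fieldType) (n j : nat) (x : R) : R :=
  x ^+ j / (1 + x ^+ 2) ^+ n.

Definition rat_sum (R : fieldType) (n : nat) (v : 'I_n -> R) (x : R) : R :=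
  \sum_(j < n) v j * rat_basis n j x.

Definition cube (R : numDomainType) (T : Type) (l : R) (t : T -> R) : Prop :=
  forall i, `|t i| <= l.

(** Clearing the denominator turns the sum into the polynomial with coefficients [v]; on the cube
    the factor is at most [(1 + A ^+ 2) ^+ #|Q|]. *)
Lemma rat_sum_interpolation (R : realFieldType) (Q : finType) (A l : R) :
  0 <= A -> 0 < l ->
  exists2 C : R, 0 <= C & forall (a : Q -> R) (v : 'I_#|Q| -> R) (e : R),
    cube A a ->
    (forall q q', q != q' -> l <= `|a q - a q'|) ->
    (forall q, `|rat_sum v (a q)| <= e) -> forall j, `|v j| <= C * e.
Proof.
move=> A0 l0; have [C C0 HC] := interpolation_bound #|Q| A0 l0.
have A1 : 0 < (1 + A ^+ 2) ^+ #|Q| by rewrite exprn_gt0 // ltr_pwDl // sqr_ge0.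
exists (C * (1 + A ^+ 2) ^+ #|Q|); first by rewrite mulr_ge0 // ltW.
move=> a v e aA al ve j; rewrite -mulrA.
have q0 : Q by exact: enum_val j.
set p := \poly_(i < #|Q|) (if insub i is Some i' then v i' else 0).
have -> : v j = p`_j by rewrite coef_poly ltn_ord valK.
apply: (HC (fun k => a (nth q0 (enum Q) k))) => //.
- exact: size_poly.
- move=> k k' kk' k'n; apply: al.
  rewrite nth_uniq ?enum_uniq -?cardE //; last exact: ltn_trans kk' k'n.
  by rewrite neq_ltn kk' orbT.
- move=> k kn; set q := nth _ _ _.
  have a1 : 0 < 1 + a q ^+ 2 by rewrite ltr_pwDl // sqr_ge0.
  have -> : p.[a q] = rat_sum v (a q) * (1 + a q ^+ 2) ^+ #|Q|.
    rewrite horner_poly /rat_sum big_distrl /=; apply: eq_bigr => i _.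
    by rewrite valK /rat_basis mulrA divfK // expf_neq0 // gt_eqF.
  rewrite normrM mulrC ler_pM //.
  rewrite ger0_norm ?exprn_ge0 ?(ltW a1) //.
  rewrite lerXn2r ?nnegrE ?(ltW a1) // ?addr_ge0 ?sqr_ge0 //.
  by rewrite lerD2l -real_normK ?num_real // lerXn2r ?nnegrE.
Qed.

(** One constant both bounds [g] on the cube and is a Lipschitz constant there for the sup distance,
    which enters through its upper bounds [h]. *)
Definition locally_lipschitz (R : numDomainType) (T : Type)
    (g : (T -> R) -> R) : Prop :=
  forall l : R, 0 < l -> exists2 L : R, 0 <= L &
    forall t t', cube l t -> cube l t' ->
      `|g t| <= L /\
      forall h, 0 <= h -> (forall i, `|t i - t' i| <= h) ->
        `|g t - g t'| <= L * h.

Lemma same_truncn_dist (R : archiRealFieldType) (x y : R) :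
  0 <= x -> 0 <= y -> Num.truncn x = Num.truncn y -> `|x - y| <= 1.
Proof.
move=> x0 y0 xy.
have /andP[] := truncn_itv x0; have /andP[] := truncn_itv y0; rewrite -xy.
rewrite -natr1 => *; rewrite ler_norml; apply/andP; split; lra.
Qed.

(** Cells of side [s^-1] cover the cube with fewer than [(kap * m) ^ #|T| < m ^ #|T|.+1 <= m ^ n]
    cells to choose from, and [m ^ n] is the number of grid points [g]. *)
Lemma pigeonhole_cell (R : archiRealFieldType) (n m kap : nat) (T : finType)
    (l s : R) (t : {ffun 'I_n -> 'I_m} -> T -> R) :
  0 < l -> 0 < s -> 2 * l * s < (kap * m)%:R -> (#|T| < n)%N ->
  (kap ^ #|T| < m)%N ->
  (forall g, cube l (t g)) ->
  exists g g', g != g' /\ forall i, `|t g i - t g' i| <= s^-1.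
Proof.
move=> l0 s0 lsK Tn km tl.
have tls0 g i : 0 <= (t g i + l) * s.
  rewrite mulr_ge0 ?(ltW s0) //; have := tl g i; rewrite ler_norml => /andP[]; lra.
have tlsK g i : (Num.truncn ((t g i + l) * s) < kap * m)%N.
  rewrite -(ltr_nat R); apply: le_lt_trans lsK.
  rewrite (le_trans _ (_ : (t g i + l) * s <= _)) ?truncn_le //.
  rewrite ler_wpM2r ?(ltW s0) //; have := tl g i; rewrite ler_norml => /andP[]; lra.
pose cell g : {ffun T -> 'I_(kap * m)} := [ffun i => Ordinal (tlsK g i)].
have [inj|] := pselect (injective cell).
  have := leq_card cell inj; rewrite !card_ffun !card_ord leqNgt.
  have m0 : (0 < m)%N by exact: leq_ltn_trans km.
  suff -> : ((kap * m) ^ #|T| < m ^ n)%N by [].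
  apply: (@leq_trans (m ^ #|T|.+1)); last by rewrite leq_pexp2l.
  by rewrite expnMn expnS ltn_pmul2r // expn_gt0 m0.
move=> /existsNP[g /existsNP[g' /not_implyP[gg' /eqP ne]]].
exists g, g'; split=> // i.
have := congr1 (fun c : {ffun T -> 'I_(kap * m)} => val (c i)) gg'.
rewrite !ffunE /= => /same_truncn_dist - /(_ (tls0 _ _) (tls0 _ _)).
rewrite -mulrBl opprD addrACA subrr addr0 normrM (gtr0_norm s0).
by rewrite -ler_pdivlMr // mul1r.
Qed.

Lemma locally_lipschitz_uniform (R : numDomainType) (T : Type) (Q : finType)
    (g : (T -> R) -> Q -> R) (l : R) :
  (forall q, locally_lipschitz (g^~ q)) -> 0 < l ->
  exists2 L : R, 0 <= L & forall t t' q, cube l t -> cube l t' ->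
    `|g t q| <= L /\
    forall h, 0 <= h -> (forall i, `|t i - t' i| <= h) ->
      `|g t q - g t' q| <= L * h.
Proof.
move=> gL l0.
have /choice[L HL] : forall q, exists L : R, 0 <= L /\
    forall t t', cube l t -> cube l t' ->
      `|g t q| <= L /\
      forall h, 0 <= h -> (forall i, `|t i - t' i| <= h) ->
        `|g t q - g t' q| <= L * h.
  by move=> q; have [L L0 H] := gL q l l0; exists L.
have LS q : L q <= \sum_q L q.
  by rewrite (bigD1 q) //= lerDl sumr_ge0 // => i _; case: (HL i).
exists (\sum_q L q); first by rewrite sumr_ge0 // => i _; case: (HL i).
move=> t t' q tl t'l; have [_ /(_ t t' tl t'l)[H1 H2]] := HL q; split.
  exact: le_trans (LS q).
move=> h h0 tt'; rewrite (le_trans (H2 h h0 tt')) // ler_wpM2r //.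
Qed.

(** Suppose that each grid vector [v g] had a parameter [t g] solving all equations up to [eta]. Two
    of these parameters share a cell; subtracting their equations makes [rat_sum (v g - v g')] small
    at separated nodes, so by interpolation [v g] and [v g'] differ by less than the grid step. *)
Lemma generic_step (R : archiRealFieldType) (T Q : finType)
    (A Y : (T -> R) -> Q -> R) (f : R -> R) (Lf Lb l d : R) :
  (#|T| < #|Q|)%N ->
  (forall q, locally_lipschitz (A^~ q)) ->
  (forall q, locally_lipschitz (Y^~ q)) ->
  (forall x y, `|f x - f y| <= Lf * `|x - y|) ->
  (forall (j : 'I_#|Q|) x y,
     `|rat_basis #|Q| j x - rat_basis #|Q| j y| <= Lb * `|x - y|) ->
  0 < l -> 0 < d ->
  exists2 v : 'I_#|Q| -> R, cube d v & exists2 eta : R, 0 < eta &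
    forall t, cube l t ->
      (forall q q', q != q' -> l^-1 <= `|A t q - A t q'|) ->
      exists q, eta < `|Y t q - (f (A t q) + rat_sum v (A t q))|.
Proof.
move=> TQ lA lY fL bL l0 d0.
have Lf0 : 0 <= Lf by have := fL 1 0; rewrite subr0 normr1 mulr1; exact: le_trans.
have Q0 : (0 < #|Q|)%N by exact: leq_ltn_trans TQ.
have Lb0 : 0 <= Lb.
  by have := bL (Ordinal Q0) 1 0; rewrite subr0 normr1 mulr1; exact: le_trans.
have [LA LA0 HA] := locally_lipschitz_uniform lA l0.
have [LY LY0 HY] := locally_lipschitz_uniform lY l0.
have il0 : 0 < l^-1 by rewrite invr_gt0.
have [C1 C10 HC] := @rat_sum_interpolation R Q LA l^-1 LA0 il0.
set n := #|Q| in Q0 TQ *.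
(* On the cube, a Lipschitz constant in the parameter of the residual [Y - f (A) - rat_sum v (A)],
   uniform over all [v] of size at most [d]. *)
pose C2 := LY + (Lf + n%:R * (d * Lb)) * LA.
have C20 : 0 <= C2 by rewrite addr_ge0 // mulr_ge0 // addr_ge0 // !mulr_ge0 // ltW.
(* Balance of constants: the grid has step [d / m], the cells have side [1 / (kap' * m)]. As [kap']
   and [kap] do not depend on [m], the counting is won by [m > kap ^ #|T|]; after interpolation the
   cell size and the two errors [eta] each cost less than half a grid step. *)
pose kap' := 2 * C1 * C2 / d + 1.
have kap'0 : 0 < kap' by rewrite ltr_pwDr // !mulr_ge0 ?invr_ge0 // ltW.
pose kap := (Num.truncn (2 * l * kap')).+1.
have Hkap : 2 * l * kap' < kap%:R.
  by rewrite /kap truncnS_gt.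
pose m := (kap ^ #|T|).+1.
have m0 : 0 < m%:R :> R by rewrite ltr0n.
pose s := kap' * m%:R.
have s0 : 0 < s by rewrite mulr_gt0.
pose eta := d / (4 * m%:R * (C1 + 1)).
have C11 : 0 < C1 + 1 by rewrite ltr_wpDl.
have eta0 : 0 < eta by rewrite divr_gt0 // !mulr_gt0.
pose v (g : {ffun 'I_n -> 'I_m}) (j : 'I_n) : R := d * (val (g j))%:R / m%:R.
have vd g : cube d (v g).
  move=> j; rewrite /v ger0_norm; last by rewrite !mulr_ge0 ?invr_ge0 ?ler0n // ltW.
  by rewrite ler_pdivrMr // ler_pM2l // ler_nat; exact: ltnW (ltn_ord _).
have [//|H] := pselect (exists2 v : 'I_#|Q| -> R, cube d v & exists2 eta : R, 0 < eta &
    forall t, cube l t ->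
      (forall q q', q != q' -> l^-1 <= `|A t q - A t q'|) ->
      exists q, eta < `|Y t q - (f (A t q) + rat_sum v (A t q))|).
have /choice[t Ht] : forall g, exists t, [/\ cube l t,
      (forall q q', q != q' -> l^-1 <= `|A t q - A t q'|) &
      forall q, `|Y t q - (f (A t q) + rat_sum (v g) (A t q))| <= eta].
  move=> g; apply: contrapT => /forallNP Hg; apply: H; exists (v g) => //.
  exists eta => // t tl At; apply: contrapT => /forallNP Hq.
  by apply: (Hg t); split=> // q; rewrite leNgt; apply/negP.
have lsK : 2 * l * s < (kap * m)%:R.
  by rewrite /s mulrA natrM ltr_pM2r.
have tl g : cube l (t g) by case: (Ht g).
have [g [g' [gg' tt']]] := pigeonhole_cell l0 s0 lsK TQ (ltnSn _) tl.
have is0 : 0 <= s^-1 by rewrite invr_ge0 ltW.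
have [_ Ag fg] := Ht g; have [_ _ fg'] := Ht g'.
set a := A (t g) in Ag fg; set a' := A (t g') in fg'.
have aa' q : `|a q - a' q| <= LA * s^-1.
  by have [_] := HA _ _ q (tl g) (tl g'); exact.
have yy' q : `|Y (t g) q - Y (t g') q| <= LY * s^-1.
  by have [_] := HY _ _ q (tl g) (tl g'); exact.
have rr' q : `|rat_sum (v g') (a' q) - rat_sum (v g') (a q)|
    <= n%:R * (d * Lb) * (LA * s^-1).
  rewrite /rat_sum -sumrB (le_trans (ler_norm_sum _ _ _)) //.
  rewrite -[n in n%:R]card_ord -mulrA mulr_natl -sumr_const ler_sum // => j _.
  rewrite -mulrBr normrM -mulrA ler_pM // ?vd //.
  by rewrite (le_trans (bL _ _ _)) // ler_wpM2l // distrC.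
have sq q : `|rat_sum (fun j => v g j - v g' j) (a q)| <= C2 * s^-1 + 2 * eta.
  have -> : rat_sum (fun j => v g j - v g' j) (a q) =
     (Y (t g) q - Y (t g') q) - (f (a q) - f (a' q)) +
     (rat_sum (v g') (a' q) - rat_sum (v g') (a q)) -
     (Y (t g) q - (f (a q) + rat_sum (v g) (a q))) +
     (Y (t g') q - (f (a' q) + rat_sum (v g') (a' q))).
    have -> : rat_sum (fun j => v g j - v g' j) (a q) =
        rat_sum (v g) (a q) - rat_sum (v g') (a q).
      by rewrite /rat_sum -sumrB; apply: eq_bigr => j _; rewrite mulrBl.
    ring.
  have ff' : `|f (a q) - f (a' q)| <= Lf * (LA * s^-1).
    by rewrite (le_trans (fL _ _)) // ler_wpM2l.
  have norm5 (b1 b2 b3 b4 b5 : R) :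
      `|b1 - b2 + b3 - b4 + b5| <= `|b1| + `|b2| + `|b3| + `|b4| + `|b5|.
    by do 4 (apply: (le_trans (ler_normD _ _)); rewrite ?normrN lerD2r).
  apply: (le_trans (norm5 _ _ _ _ _)).
  apply: (le_trans (lerD (lerD (lerD (lerD (yy' q) ff') (rr' q)) (fg q)) (fg' q))).
  by rewrite le_eqVlt; apply/orP; left; apply/eqP; rewrite /C2; ring.
have aLA : cube LA a by move=> q; have [] := HA _ _ q (tl g) (tl g').
have vv' := HC a _ _ aLA Ag sq.
have /existsP[j gj] : [exists j, g j != g' j].
  by apply: contraR gg' => /existsPn E; apply/eqP/ffunP => j; apply/eqP; rewrite -[_ == _]negbK E.
have := vv' j; rewrite leNgt => /negP[].
have h1 : C1 * (C2 * s^-1) < d / m%:R / 2.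
  rewrite /s invfM.
  have -> : C1 * (C2 * (kap'^-1 * m%:R^-1)) = (C1 * C2 / kap') / m%:R by ring.
  rewrite [ltRHS]mulrAC ltr_pM2r ?invr_gt0 // ltr_pdivrMr //.
  rewrite /kap' [ltRHS]mulrDr mulr1.
  have -> : d / 2 * (2 * C1 * C2 / d) = C1 * C2 by field; rewrite gt_eqF.
  by rewrite ltrDl divr_gt0.
have h2 : C1 * (2 * eta) < d / m%:R / 2.
  have -> : C1 * (2 * eta) = d / m%:R / 2 * (C1 / (C1 + 1)).
    by rewrite /eta; field; rewrite !gt_eqF.
  rewrite gtr_pMr ?divr_gt0 // ltr_pdivrMr // mul1r ltrDl //.
have h3 : d / m%:R <= `|v g j - v g' j|.
  have -> : v g j - v g' j = d / m%:R * ((g j)%:R - (g' j)%:R) by rewrite /v; ring.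
  rewrite normrM gtr0_norm ?divr_gt0 // ler_pMr ?divr_gt0 //.
  have : (g j != g' j :> nat) by [].
  rewrite neq_ltn => /orP[] h.
    rewrite distrC ger0_norm; last by rewrite subr_ge0 ler_nat ltnW.
    by rewrite lerBrDr addrC natr1 ler_nat.
  rewrite ger0_norm; last by rewrite subr_ge0 ler_nat ltnW.
  by rewrite lerBrDr addrC natr1 ler_nat.
lra.
Qed.

(** * Parametrized systems of equations *)

Section LocallyLipschitz.
Context (R : numDomainType) (T : Type).
Implicit Types g : (T -> R) -> R.

Lemma locally_lipschitz_coord (i : T) : locally_lipschitz (fun t : T -> R => t i).
Proof.
move=> l l0; exists (l + 1); first by rewrite addr_ge0 // ltW.
move=> t t' tl _; split; first by rewrite (le_trans (tl i)) // lerDl.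
move=> h h0 /(_ i) /le_trans; apply.
by rewrite ler_peMl // lerDr ltW.
Qed.

Lemma locally_lipschitz_cst (c : R) : locally_lipschitz (fun _ : T -> R => c).
Proof.
move=> l l0; exists `|c| => // t t' _ _; split=> // h h0 _.
by rewrite subrr normr0 mulr_ge0.
Qed.

Lemma locally_lipschitzD g1 g2 : locally_lipschitz g1 -> locally_lipschitz g2 ->
  locally_lipschitz (fun t => g1 t + g2 t).
Proof.
move=> h1 h2 l l0; have [L1 L10 {}h1] := h1 l l0; have [L2 L20 {}h2] := h2 l l0.
exists (L1 + L2); first exact: addr_ge0.
move=> t t' tl t'l; have [b1 {}h1] := h1 t t' tl t'l.
have [b2 {}h2] := h2 t t' tl t'l; split.
  by rewrite (le_trans (ler_normD _ _)) // lerD.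
move=> h h0 tt'; rewrite opprD addrACA (le_trans (ler_normD _ _)) // mulrDl.
by rewrite lerD ?h1 ?h2.
Qed.

Lemma locally_lipschitzM g1 g2 : locally_lipschitz g1 -> locally_lipschitz g2 ->
  locally_lipschitz (fun t => g1 t * g2 t).
Proof.
move=> h1 h2 l l0; have [L1 L10 {}h1] := h1 l l0; have [L2 L20 {}h2] := h2 l l0.
have p0 : 0 <= L1 * L2 by exact: mulr_ge0.
exists (L1 * L2 + L1 * L2); first exact: addr_ge0.
move=> t t' tl t'l; have [b1 {}h1] := h1 t t' tl t'l.
have [b2' _] := h2 t' t' t'l t'l; have [b2 {}h2] := h2 t t' tl t'l; split.
  by rewrite normrM (@le_trans _ _ (L1 * L2)) ?lerDl // ler_pM.
move=> h h0 tt'.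
have -> : g1 t * g2 t - g1 t' * g2 t' =
    (g1 t - g1 t') * g2 t' + g1 t * (g2 t - g2 t').
  by ring.
rewrite (le_trans (ler_normD _ _)) // !normrM mulrDl lerD //.
  by rewrite mulrAC ler_pM ?h1.
by rewrite -mulrA ler_pM ?h2.
Qed.

Lemma locally_lipschitz_sum (I : finType) (G : I -> (T -> R) -> R) :
  (forall i, locally_lipschitz (G i)) ->
  locally_lipschitz (fun t => \sum_i G i t).
Proof.
move=> GL.
suff H (r : seq I) : locally_lipschitz (fun t => \sum_(i <- r) G i t) by exact: H.
elim: r => [|i r IH].
  by under eq_fun do rewrite big_nil; exact: locally_lipschitz_cst.
by under eq_fun do rewrite big_cons; exact: locally_lipschitzD.
Qed.

End LocallyLipschitz.

(* The coordinates of a parameter vector [t] are the bias, the input weights and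
   the weights on [u] units of [u + 2] affine forms, followed by the values taken
   by the [u] units at the sample points. *)
Definition param_index (D u M : nat) : finType :=
  ('I_u.+2 * option ('I_D + 'I_u) + 'I_M * 'I_u)%type.

(** One more than the number of coefficients of the [u + 2] affine forms. *)
Definition num_samples (D u : nat) : nat := (u.+2 * (D + u).+1).+1.

(** [M] samples give [M * (u + 1)] equations and [M * u] unknown unit values; the surplus [M]
    exceeds the number of coefficients. *)
Lemma card_param_index (D u : nat) :
  (#|param_index D u (num_samples D u)| < #|{: 'I_(num_samples D u) * 'I_u.+1}|)%N.
Proof.
rewrite /param_index card_sum !card_prod card_option card_sum !card_ord.
by rewrite [X in (_ < X)%N]mulnS ltn_add2r.
Qed.

(** Lists of rationals form a countable type, so the systems built on such sample points can be
    enumerated by [pickle]. *)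
Definition rat_point (R : realType) (D : nat) (xi : seq rat) : 'cV[R]_D :=
  \col_j ratr (nth 0 xi j).

Section ParamMaps.
Context (R : realType) (D u M : nat) (X : seq (seq rat)).
Implicit Type t : param_index D u M -> R.

Definition param_form t (m : 'I_M) (k : 'I_u.+2) : R :=
  t (inl (k, None)) +
  \sum_j t (inl (k, Some (inl j))) * rat_point R D (nth [::] X m) j 0 +
  \sum_i t (inl (k, Some (inr i))) * t (inr (m, i)).

Definition param_arg t (q : 'I_M * 'I_u.+1) : R :=
  param_form t q.1 (widen_ord (leqnSn _) q.2).

(** The value required of [sigma] at each argument: for the first [u] forms an unknown unit value,
    for the form of index [u] the right-hand side of a relation, which is stored as the form
    [ord_max]. *)
Definition param_val t (q : 'I_M * 'I_u.+1) : R :=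
  if unlift ord_max q.2 is Some i then t (inr (q.1, i))
  else param_form t q.1 ord_max.

Lemma locally_lipschitz_param_form m k :
  locally_lipschitz (fun t => param_form t m k).
Proof.
apply: locally_lipschitzD; first apply: locally_lipschitzD.
- exact: locally_lipschitz_coord.
- apply: locally_lipschitz_sum => j; apply: locally_lipschitzM.
    exact: locally_lipschitz_coord.
  exact: locally_lipschitz_cst.
- apply: locally_lipschitz_sum => i.
  by apply: locally_lipschitzM; exact: locally_lipschitz_coord.
Qed.

Lemma locally_lipschitz_param_arg q : locally_lipschitz (param_arg^~ q).
Proof. exact: locally_lipschitz_param_form. Qed.

Lemma locally_lipschitz_param_val q : locally_lipschitz (param_val^~ q).
Proof.
rewrite /param_val; case: unliftP => [i _|_]; first exact: locally_lipschitz_coord.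
exact: locally_lipschitz_param_form.
Qed.

End ParamMaps.

Definition generic_fun (R : realType) (D : nat) (sigma : R -> R) : Prop :=
  forall u X (t : param_index D u (num_samples D u) -> R),
    injective (param_arg X t) ->
    exists q, param_val X t q <> sigma (param_arg X t q).

Definition lipschitz_fun (R : numDomainType) (f : R -> R) : Prop :=
  exists2 L : R, 0 <= L & forall x y, `|f x - f y| <= L * `|x - y|.

(** * Circuits *)

Section Circuits.
Context (R : realType) (D : nat) (sigma : R -> R).
Context (sigma_lip : lipschitz_fun sigma) (sigma_gen : generic_fun D sigma).

Local Notation E := ('cV[R]_D -> R).

Definition box (x0 : 'cV[R]_D) (r : R) : set 'cV[R]_D :=
  [set x | forall j, `|x j 0 - x0 j 0| < r].

Definition mlipschitz (f : E) : Prop :=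
  exists2 L : R, 0 <= L & forall (x y : 'cV[R]_D) (h : R), 0 <= h ->
    (forall j, `|x j 0 - y j 0| <= h) -> `|f x - f y| <= L * h.

Lemma mlipschitz_cst c : mlipschitz (fun=> c).
Proof. by exists 0 => // x y h h0 _; rewrite subrr normr0 mul0r. Qed.

Lemma mlipschitz_coord j : mlipschitz (fun x => x j 0).
Proof. by exists 1 => // x y h h0 /(_ j); rewrite mul1r. Qed.

Lemma mlipschitzD f g : mlipschitz f -> mlipschitz g ->
  mlipschitz (fun x => f x + g x).
Proof.
move=> [L1 L10 h1] [L2 L20 h2]; exists (L1 + L2); first exact: addr_ge0.
move=> x y h h0 xy; rewrite opprD addrACA mulrDl (le_trans (ler_normD _ _)) //.
by rewrite lerD ?h1 ?h2.
Qed.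

Lemma mlipschitzZ c f : mlipschitz f -> mlipschitz (fun x => c * f x).
Proof.
move=> [L L0 hL]; exists (`|c| * L); first exact: mulr_ge0.
by move=> x y h h0 xy; rewrite -mulrBr normrM -mulrA ler_pM ?hL.
Qed.

Lemma mlipschitz_sum (I : Type) (r : seq I) (F : I -> E) :
  (forall i, mlipschitz (F i)) -> mlipschitz (fun x => \sum_(i <- r) F i x).
Proof.
move=> FL; elim: r => [|i r IH].
  by under eq_fun do rewrite big_nil; exact: mlipschitz_cst.
by under eq_fun do rewrite big_cons; exact: mlipschitzD.
Qed.

Lemma mlipschitz_sigma f : mlipschitz f -> mlipschitz (fun x => sigma (f x)).
Proof.
move=> [L L0 hL]; have [M M0 hM] := sigma_lip.
exists (M * L); first exact: mulr_ge0.
by move=> x y h h0 xy; rewrite (le_trans (hM _ _)) // -mulrA ler_wpM2l ?hL.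
Qed.

(** The zero set has empty interior, and the Lipschitz condition lets a nonzero value persist on a
    smaller box. *)
Definition nonvanishing (g : E) : Prop :=
  mlipschitz g /\ forall x0 r, 0 < r -> exists2 x, box x0 r x & g x <> 0.

(** A finite Baire argument: the box shrinks once for each function of the list. *)
Lemma nonvanishing_subbox (gs : seq E) x0 r :
  (forall g, g \in gs -> nonvanishing g) -> 0 < r ->
  exists x1 r1, [/\ 0 < r1, box x1 r1 `<=` box x0 r &
    forall x g, box x1 r1 x -> g \in gs -> g x <> 0].
Proof.
elim: gs x0 r => [|g gs IH] x0 r gsN r0; first by exists x0, r; split=> // x g _; rewrite in_nil.
have [|x1 [r1 [r10 sub1 gs1]]] := IH x0 r _ r0.
  by move=> g' g'gs; apply: gsN; rewrite in_cons g'gs orbT.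
have [[L L0 gL] gN] := gsN g (mem_head _ _).
have r12 : 0 < r1 / 2 by rewrite divr_gt0.
have [x2 x2b gx2] := gN x1 (r1 / 2) r12.
have gx20 : 0 < `|g x2| by rewrite normr_gt0; apply/eqP.
have L10 : 0 < L + 1 by rewrite ltr_wpDl.
(* Within this radius [g] varies by at most [L / (L + 1)] times [|g x2|], so it cannot reach 0. *)
pose r2 := Num.min (r1 / 2) (`|g x2| / (L + 1)).
have r20 : 0 < r2 by rewrite lt_min !divr_gt0.
have sub2 : box x2 r2 `<=` box x1 r1.
  move=> x xb j; have := xb j; have := x2b j.
  rewrite lt_min => h1 /andP[h2 _].
  rewrite -(subrK (x2 j 0) (x j 0)) -addrA (le_lt_trans (ler_normD _ _)) //.
  by rewrite [ltRHS](splitr r1) ltrD.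
exists x2, r2; split=> //; first exact: subset_trans sub1.
move=> x g' xb; rewrite in_cons => /orP[/eqP -> |g'gs]; last exact/gs1/g'gs/sub2.
move=> gx0; have : `|g x2 - g x| <= L * (`|g x2| / (L + 1)).
  apply: gL; first by rewrite divr_ge0 // ltW.
  by move=> j; have := xb j; rewrite lt_min distrC => /andP[_ /ltW].
rewrite gx0 subr0 leNgt mulrCA gtr_pMr // ltr_pdivrMr // mul1r ltrDl ltr01 //.
Qed.

Lemma rat_point_box x0 r : 0 < r -> exists xi, box x0 r (rat_point R D xi).
Proof.
move=> r0.
have /choice[q hq] : forall j : 'I_D, exists q : rat,
    ratr q \in `](x0 j 0 - r), (x0 j 0 + r)[%R.
  by move=> j; apply: rat_in_itvoo; lra.
exists [seq q j | j <- enum 'I_D] => j; rewrite mxE.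
rewrite (nth_map j) ?size_enum_ord // nth_ord_enum.
have := hq j; rewrite in_itv /= ltr_norml => /andP[h1 h2].
by apply/andP; split; lra.
Qed.

Definition sample_separated (fs : seq E) (X : seq (seq rat)) : Prop :=
  forall m m' f f', (m < size X)%N -> (m' < size X)%N -> f \in fs -> f' \in fs ->
    f (rat_point R D (nth [::] X m)) = f' (rat_point R D (nth [::] X m')) ->
    m = m' /\ f = f'.

(** A new point has to avoid the zeros of all differences [f - g] and the points where some [f]
    repeats a value taken at an earlier sample. These finitely many conditions hold throughout some
    smaller box, which contains a rational point. *)
Lemma sample_points (fs : seq E) x0 r (M : nat) : 0 < r ->
  (forall f g, f \in fs -> g \in fs -> f != g ->
     nonvanishing (fun x => f x + - g x)) ->
  (forall f c, f \in fs -> nonvanishing (fun x => f x + c)) ->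
  exists X, [/\ size X = M, forall xi, xi \in X -> box x0 r (rat_point R D xi) &
    sample_separated fs X].
Proof.
move=> r0 fgN fcN; elim: M => [|M [X [sX Xb Xs]]]; first by exists [::].
pose gs : seq E := [seq (fun x => fg.1 x + - fg.2 x) |
    fg <- [seq fg <- [seq (f, g) | f <- fs, g <- fs] | fg.1 != fg.2]] ++
  [seq (fun x => f x + c) | f <- fs,
     c <- [seq - f (rat_point R D xi) | f <- fs, xi <- X]].
have gsN g : g \in gs -> nonvanishing g.
  rewrite mem_cat => /orP[|].
    move=> /mapP[[f f']]; rewrite mem_filter /= => /andP[ff'].
    move=> /allpairsP[[g1 g2] [/= g1s g2s [e1 e2]]] ->.
    by subst f f'; exact: fgN.
  by move=> /allpairsP[[f c] [/= ffs _ ->]]; exact: fcN.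
have [x1 [r1 [r10 sub1 gs0]]] := nonvanishing_subbox x0 gsN r0.
have [xi xib] := rat_point_box x1 r10.
have new_ne f f' : f \in fs -> f' \in fs -> f (rat_point R D xi) = f' (rat_point R D xi) -> f = f'.
  move=> ffs f'fs ff'; apply/eqP/negP => /negP ne.
  apply: (gs0 _ (fun x => f x + - f' x) xib); last by rewrite ff' subrr.
  rewrite mem_cat; apply/orP; left; apply/mapP; exists (f, f') => //.
  by rewrite mem_filter ne /=; apply/allpairsP; exists (f, f').
have new_old f f' xi' : f \in fs -> f' \in fs -> xi' \in X ->
    f (rat_point R D xi) = f' (rat_point R D xi') -> False.
  move=> ffs f'fs xi'X ff'.
  apply: (gs0 _ (fun x => f x + - f' (rat_point R D xi')) xib); last by rewrite ff' subrr.
  rewrite mem_cat; apply/orP; right; apply/allpairsP.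
  exists (f, - f' (rat_point R D xi')); split=> //=.
  by apply/allpairsP; exists (f', xi').
exists (xi :: X); split; first by rewrite /= sX.
  by move=> xi'; rewrite in_cons => /orP[/eqP ->|/Xb //]; exact: sub1.
move=> [|m] [|m'] f f' /= hm hm' ffs f'fs.
- by move=> /new_ne ->.
- by move=> /new_old; case=> //; rewrite mem_nth.
- by move=> /esym /new_old; case=> //; rewrite mem_nth.
- by move=> /Xs[] // -> ->.
Qed.

(** Coefficients are indexed by the functions themselves rather than by positions, so that
    combinations over different lists can be compared. *)
Definition lincomb (s : seq E) (th : R) (w : 'I_D -> R) (c : E -> R) : E :=
  fun x => th + \sum_j w j * x j 0 + \sum_(f <- s) c f * sigma (f x).

(** Freeness on every box, however small, is what makes each combination that is not identically
    zero [nonvanishing], so that sample points exist. *)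
Definition locally_free (s : seq E) : Prop :=
  forall x0 r th w c, 0 < r -> (forall x, box x0 r x -> lincomb s th w c x = 0) ->
    [/\ th = 0, forall j, w j = 0 & forall f, f \in s -> c f = 0].

Lemma lincombB s th w c th' w' c' x :
  lincomb s th w c x - lincomb s th' w' c' x =
  lincomb s (th - th') (fun j => w j - w' j) (fun f => c f - c' f) x.
Proof.
rewrite /lincomb; under [X in _ = _ + X + _]eq_bigr do rewrite mulrBl.
under [X in _ = _ + X]eq_bigr do rewrite mulrBl.
by rewrite !sumrB; ring.
Qed.

Lemma lincomb_eq0 s th w c x : th = 0 -> (forall j, w j = 0) ->
  (forall f, f \in s -> c f = 0) -> lincomb s th w c x = 0.
Proof.
move=> -> w0 c0; rewrite /lincomb add0r big1 ?add0r => [|j _]; last by rewrite w0 mul0r.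
by rewrite big_seq big1 // => f /c0 ->; rewrite mul0r.
Qed.

Lemma mlipschitz_lincomb s th w c : (forall f, f \in s -> mlipschitz f) ->
  mlipschitz (lincomb s th w c).
Proof.
move=> sL; apply: mlipschitzD; first apply: mlipschitzD.
- exact: mlipschitz_cst.
- by apply: mlipschitz_sum => j; apply: mlipschitzZ; exact: mlipschitz_coord.
- elim: s sL => [|f s IH] sL.
    by under eq_fun do rewrite big_nil; exact: mlipschitz_cst.
  under eq_fun do rewrite big_cons; apply: mlipschitzD.
    by apply/mlipschitzZ/mlipschitz_sigma/sL; rewrite mem_head.
  by apply: IH => g gs; apply: sL; rewrite in_cons gs orbT.
Qed.

Lemma lincomb_nonvanishing s th w c : locally_free s ->
  (forall f, f \in s -> mlipschitz f) ->
  (exists x, lincomb s th w c x <> 0) -> nonvanishing (lincomb s th w c).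
Proof.
move=> sfree sL [x1 x1N]; split; first exact: mlipschitz_lincomb.
move=> x0 r r0; apply: contrapT => H; apply: x1N.
have [] := sfree x0 r th w c r0.
  by move=> x xb; apply: contrapT => nx; apply: H; exists x.
exact: lincomb_eq0.
Qed.

Definition nonconstant (a : E) : Prop := forall c, exists x, a x <> c.

(** The coefficients of the forms in [a :: s] and of the relation, together with the unit values at
    the sample points, would solve a system that genericity excludes. Distinctness and nonconstancy
    of the forms separate the arguments at the samples. *)
Lemma no_relation (s : seq E) (a : E) x0 r th w c :
  uniq (a :: s) -> locally_free s -> (forall f, f \in s -> mlipschitz f) ->
  (forall f, f \in a :: s -> nonconstant f) ->
  (forall f, f \in a :: s -> exists th' w' c', f = lincomb s th' w' c') ->
  0 < r -> ~ (forall x, box x0 r x -> sigma (a x) = lincomb s th w c x).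
Proof.
move=> us sfree sL sN sC r0 rel.
have /choice[dat Hdat] : forall f : E, exists d : R * ('I_D -> R) * (E -> R),
    f \in a :: s -> f = lincomb s d.1.1 d.1.2 d.2.
  move=> f; have [/sC[th' [w' [c' e]]]|] := boolP (f \in a :: s); last first.
    by exists (0, fun=> 0, fun=> 0).
  by exists (th', w', c').
have lincomb_addc th' w' c' k x :
    lincomb s th' w' c' x + k = lincomb s (th' + k) w' c' x.
  by rewrite /lincomb; ring.
have addN f k : f \in a :: s -> nonvanishing (fun x => f x + k).
  move=> fs; rewrite (Hdat f fs) //.
  under eq_fun do rewrite lincomb_addc; apply: lincomb_nonvanishing => //.
  have [x fx] := sN f fs (- k); exists x; rewrite -lincomb_addc -(Hdat f fs).
  by move/eqP; rewrite addr_eq0 => /eqP.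
have subN f g : f \in a :: s -> g \in a :: s -> f != g ->
    nonvanishing (fun x => f x + - g x).
  move=> fs gs fg; rewrite (Hdat f fs) (Hdat g gs).
  under eq_fun do rewrite lincombB; apply: lincomb_nonvanishing => //.
  apply: contrapT => /forallNP H; move/eqP: fg; apply; apply/funext => x.
  apply/eqP; rewrite -subr_eq0; apply/eqP.
  by have := H x; rewrite -lincombB -(Hdat f fs) -(Hdat g gs) => /contrapT.
have [X [sX Xb Xs]] := sample_points x0 (num_samples D (size s)) r0 subN addN.
set u := size s in sX *; set M := num_samples D u in sX *.
(* [nth] falls back on its default at index [size s]: the forms [0, ..., u] are those of [s]
   followed by [a]. The remaining index [ord_max] carries the relation itself. *)
pose unit (k : 'I_u.+2) : E := nth a s k.
pose pth (k : 'I_u.+2) := if k == ord_max then th else (dat (unit k)).1.1.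
pose pw (k : 'I_u.+2) := if k == ord_max then w else (dat (unit k)).1.2.
pose pc (k : 'I_u.+2) := if k == ord_max then c else (dat (unit k)).2.
pose t (p : param_index D u M) : R := match p with
  | inl (k, None) => pth k
  | inl (k, Some (inl j)) => pw k j
  | inl (k, Some (inr i)) => pc k (nth a s i)
  | inr (m, i) => sigma (nth a s i (rat_point R D (nth [::] X m))) end.
have formE m k : param_form X t m k =
    lincomb s (pth k) (pw k) (pc k) (rat_point R D (nth [::] X m)).
  by rewrite /param_form /lincomb; congr (_ + _); rewrite (big_nth a) big_mkord.
have unit_mem (k : 'I_u.+1) : nth a s k \in a :: s.
  have [ks|ks] := ltnP k u; first by rewrite in_cons mem_nth ?orbT.
  by rewrite nth_default // mem_head.
have argE q : param_arg X t q = nth a s q.2 (rat_point R D (nth [::] X q.1)).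
  rewrite /param_arg formE /pth /pw /pc.
  have -> : (widen_ord (leqnSn u.+1) q.2 == ord_max) = false.
    by apply/eqP => /(congr1 val) /= /eqP; rewrite ltn_eqF.
  by rewrite [RHS](congr1 (fun f => f _) (Hdat _ (unit_mem q.2))).
have lX (m : 'I_M) : (m < size X)%N by rewrite sX.
have [|q] := sigma_gen (u := u) (X := X) (t := t).
  move=> [m k] [m' k'] /=; rewrite !argE /=.
  move=> /(Xs _ _ _ _ (lX m) (lX m') (unit_mem k) (unit_mem k'))[/val_inj -> kk'].
  congr (_, _); apply/val_inj/eqP => /=.
  have nthE (i : 'I_u.+1) : nth a s i = nth a (rcons s a) i.
    rewrite nth_rcons; case: ltnP => // ui; rewrite nth_default //.
    by case: eqP.
  move/eqP: kk'; rewrite !nthE nth_uniq ?size_rcons ?ltn_ord //.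
  by rewrite rcons_uniq.
apply; rewrite argE /param_val; case: unliftP => [i|] qE /=.
  by rewrite qE lift_max.
rewrite formE /pth /pw /pc eqxx -rel; last by apply: Xb; rewrite mem_nth.
by rewrite qE (@nth_default _ a).
Qed.

(** A straight-line program read from its tail: each preactivation is built from units further down
    the list. Layers are forgotten, so networks of different depths fit into one circuit. *)
Fixpoint circuit (s : seq E) : Prop :=
  if s is a :: s' then
    [/\ circuit s', a \notin s', nonconstant a &
       exists th w c, a = lincomb s' th w c]
  else True.

Lemma circuit_uniq s : circuit s -> uniq s.
Proof. by elim: s => //= a s IH [/IH -> ->]. Qed.

Lemma circuit_nonconstant s f : circuit s -> f \in s -> nonconstant f.
Proof.
elim: s => // a s IH [cs _ aN _]; rewrite in_cons => /orP[/eqP -> //|].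
exact: IH.
Qed.

Lemma lincomb_extend (s s' : seq E) th w c : uniq s -> uniq s' ->
  {subset s <= s'} ->
  lincomb s th w c = lincomb s' th w (fun f => if f \in s then c f else 0).
Proof.
move=> us us' ss'; apply/funext => x; rewrite /lincomb; congr (_ + _).
under [RHS]eq_bigr => f _ do rewrite (fun_if (fun y => y * sigma (f x))) mul0r.
rewrite -big_mkcond -big_filter /=; apply: perm_big; apply: uniq_perm => //.
  by rewrite filter_uniq.
by move=> f; rewrite mem_filter; case: (boolP (f \in s)) => // /ss' ->.
Qed.

Lemma circuit_lincomb s s' f : circuit s -> f \in s -> uniq s' ->
  {subset behead s <= s'} -> exists th w c, f = lincomb s' th w c.
Proof.
move=> cs fs us' ss'.
elim: s cs fs ss' => // a s IH [cs ans aN [th [w [c aE]]]] fs ss'.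
move: fs; rewrite in_cons => /orP[/eqP ->|fs].
  exists th, w, (fun f => if f \in s then c f else 0).
  by rewrite {1}aE; apply: lincomb_extend => //; exact: circuit_uniq.
by apply: IH => // g /mem_behead; exact: ss'.
Qed.

Lemma circuit_mlipschitz s f : circuit s -> f \in s -> mlipschitz f.
Proof.
elim: s f => // a s IH f [cs ans aN [th [w [c ->]]]].
rewrite in_cons => /orP[/eqP ->|]; last exact: IH.
by apply: mlipschitz_lincomb => g; exact: IH.
Qed.

Lemma affine_locally_free : locally_free [::].
Proof.
move=> x0 r th w c r0 H.
have Hx x : box x0 r x -> th + \sum_j w j * x j 0 = 0.
  by move=> /H; rewrite /lincomb big_nil addr0.
have x0b : box x0 r x0 by move=> j; rewrite subrr normr0.
have w0 j : w j = 0.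
  pose x1 := x0 + (r / 2) *: delta_mx j 0 : 'cV[R]_D.
  have x1b : box x0 r x1.
    move=> i; rewrite !mxE [x0 i 0 + _]addrC addrK eqxx andbT.
    case: eqP => _; rewrite ?mulr0 ?normr0 // mulr1 gtr0_norm ?divr_gt0 //; lra.
  have : \sum_j w j * x1 j 0 - \sum_j w j * x0 j 0 = 0.
    by rewrite -[X in _ - X](addKr th) Hx // addr0 opprK addrC Hx.
  rewrite -sumrB (bigD1 j) //= big1 ?addr0 => [|i ij].
    rewrite -mulrBr !mxE !eqxx [x0 j 0 + _]addrC addrK mulr1 => /eqP.
    by rewrite mulf_eq0 => /orP[/eqP //|]; rewrite gt_eqF ?divr_gt0.
  by rewrite -mulrBr !mxE (negbTE ij) /= mulr0 addr0 subrr mulr0.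
split=> //; have := Hx x0 x0b; rewrite big1 ?addr0 // => j _.
by rewrite w0 mul0r.
Qed.

(** Were the coefficient of the head nonzero, dividing by it would produce a relation excluded by
    [no_relation]; otherwise the combination lives on the tail. *)
Lemma circuit_locally_free s : circuit s -> locally_free s.
Proof.
elim: s => [_|a s IH cas]; first exact: affine_locally_free.
have [cs ans aN aC] := cas; have us := circuit_uniq cs.
move=> x0 r th w c r0 H.
have HE x : lincomb (a :: s) th w c x = c a * sigma (a x) + lincomb s th w c x.
  by rewrite /lincomb big_cons; ring.
have ca0 : c a = 0.
  apply/eqP/negP => /negP ca.
  apply: (@no_relation s a x0 r (- th / c a) (fun j => - w j / c a)
      (fun f => - c f / c a)) => //.
  - exact: circuit_uniq cas.
  - exact: IH.
  - by move=> f; exact: circuit_mlipschitz.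
  - by move=> f; exact: circuit_nonconstant.
  - by move=> f fas; apply: circuit_lincomb cas fas us _.
  - move=> x /H; rewrite HE => /eqP; rewrite addr_eq0 => /eqP cE.
    have -> : sigma (a x) = - lincomb s th w c x / c a by rewrite -cE mulrC mulKf.
    rewrite /lincomb !opprD !mulrDl -!sumrN !mulr_suml.
    by congr (_ + _ + _); apply: eq_bigr => i _; ring.
have [|th0 w0 c0] := IH cs x0 r th w c r0.
  by move=> x xb; have := H x xb; rewrite HE ca0 mul0r add0r.
by split=> // f; rewrite in_cons => /orP[/eqP ->|/c0].
Qed.

(** Units of different networks become entries of a single circuit, where coinciding functions are
    entered once. *)
Lemma circuit_merge s s' : circuit s -> circuit s' ->
  exists2 t, circuit t & {subset s ++ s' <= t}.
Proof.
move=> cs; elim: s' => [_|a s' IH]; first by exists s => // f; rewrite cats0.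
move=> cas'; have [cs' _ aN aC] := cas'; have [t ct st] := IH cs'.
have ss't : {subset s' <= t} by move=> f fs'; apply: st; rewrite mem_cat fs' orbT.
have st' : {subset s <= t} by move=> f fs'; apply: st; rewrite mem_cat fs'.
have [at_|ant] := boolP (a \in t).
  exists t => // f; rewrite mem_cat in_cons => /or3P[/st' //|/eqP -> //|/ss't //].
exists (a :: t).
  split=> //; apply: (circuit_lincomb cas') => //; first exact: mem_head.
  exact: circuit_uniq.
move=> f; rewrite mem_cat in_cons [f \in a :: t]in_cons.
by case/or3P => [/st' ->|->|/ss't ->]; rewrite ?orbT.
Qed.

Definition preact_fun (a : E) : Prop := exists2 s, circuit s & a \in s.

Lemma preact_circuit (I : finType) (a : I -> E) :
  (forall i, preact_fun (a i)) ->
  exists2 s, circuit s & forall i, a i \in s.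
Proof.
move=> aP.
suff [s cs H] : exists2 s, circuit s & forall i, i \in enum I -> a i \in s.
  by exists s => // i; apply: H; rewrite mem_enum.
elim: (enum I) => [|i r [s cs IH]]; first by exists [::].
have [s' cs' ais'] := aP i; have [t ct tE] := circuit_merge cs cs'.
exists t => // j; rewrite in_cons => /orP[/eqP ->|/IH ajs].
  by apply: tE; rewrite mem_cat ais' orbT.
by apply: tE; rewrite mem_cat ajs.
Qed.

Lemma family_lincomb (I : finType) (a : I -> E) (k : I -> R) s th w :
  uniq s -> (forall i, a i \in s) ->
  (fun x : 'cV[R]_D => th + \sum_j w j * x j 0 + \sum_i k i * sigma (a i x)) =
  lincomb s th w (fun f => \sum_(i | a i == f) k i).
Proof.
move=> us ais; apply/funext => x; rewrite /lincomb; congr (_ + _).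
under [RHS]eq_bigr do rewrite mulr_suml.
rewrite (exchange_big_dep predT) //=; apply: eq_bigr => i _.
rewrite big_mkcond (bigD1_seq (a i)) //= eqxx big1 ?addr0 // => f fai.
by rewrite eq_sym (negbTE fai).
Qed.

(** The family may contain repetitions, so only the sum of the coefficients over each fibre of [a]
    is determined. *)
Theorem preact_independent (I : finType) (a : I -> E) (k : I -> R) th w :
  (forall i, preact_fun (a i)) ->
  (forall x : 'cV[R]_D,
     th + \sum_j w j * x j 0 + \sum_i k i * sigma (a i x) = 0) ->
  [/\ th = 0, forall j, w j = 0 & forall f, \sum_(i | a i == f) k i = 0].
Proof.
move=> aP H; have [s cs ais] := preact_circuit aP.
have := family_lincomb k th w (circuit_uniq cs) ais => lE.
have [||th0 w0 c0] := @circuit_locally_free s cs 0 1 th w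
    (fun f => \sum_(i | a i == f) k i) => //.
  by move=> x _; rewrite -lE.
split=> // f; have [/c0 //|fs] := boolP (f \in s).
by rewrite big1 // => i /eqP aif; rewrite -aif ais in fs.
Qed.

Lemma preact_fun_lincomb (I : finType) (a : I -> E) (k : I -> R) th w (b : E) :
  (forall i, preact_fun (a i)) -> nonconstant b ->
  (forall x : 'cV[R]_D, b x = th + \sum_j w j * x j 0 + \sum_i k i * sigma (a i x)) ->
  preact_fun b.
Proof.
move=> aP bN bE; have [s cs ais] := preact_circuit aP.
have [bs|bns] := boolP (b \in s); first by exists s.
exists (b :: s); last exact: mem_head.
split=> //; exists th, w, (fun f => \sum_(i | a i == f) k i).
by rewrite -family_lincomb //; [exact/funext|exact: circuit_uniq].
Qed.

End Circuits.

(** * Networks *)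

Section Networks.
Context (R : realType) (D : nat) (sigma : R -> R).
Context (sigma_lip : lipschitz_fun sigma) (sigma_gen : generic_fun D sigma).

Local Notation E := ('cV[R]_D -> R).

Lemma expansion_eq (I I' : finType) (a : I -> E) (a' : I' -> E)
    (k : I -> R) (k' : I' -> R) th th' w w' :
  (forall i, preact_fun sigma (a i)) -> (forall i, preact_fun sigma (a' i)) ->
  (forall x : 'cV[R]_D,
     th + \sum_j w j * x j 0 + \sum_i k i * sigma (a i x) =
     th' + \sum_j w' j * x j 0 + \sum_i k' i * sigma (a' i x)) ->
  [/\ th = th', forall j, w j = w' j &
    forall f, \sum_(i | a i == f) k i = \sum_(i | a' i == f) k' i].
Proof.
move=> aP a'P H.
have [||th0 w0 c0] := preact_independent sigma_lip sigma_gen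
  (a := fun i : I + I' => match i with inl i => a i | inr i => a' i end)
  (k := fun i : I + I' => match i with inl i => k i | inr i => - k' i end)
  (th := th - th') (w := fun j => w j - w' j).
- by case.
- move=> x; rewrite big_sumType /=.
  under eq_bigr do rewrite mulrBl.
  under [X in _ + (_ + X)]eq_bigr do rewrite mulNr.
  by rewrite sumrB sumrN; have := H x; lra.
- split=> [|j|f].
  + by apply/eqP; rewrite -subr_eq0 th0.
  + by apply/eqP; rewrite -subr_eq0 w0.
  have := c0 f; rewrite big_sumType /= sumrN => /eqP.
  by rewrite subr_eq0 => /eqP.
Qed.

Lemma sum_injective (I : finType) (a : I -> E) (k : I -> R) i :
  injective a -> \sum_(i' | a i' == a i) k i' = k i.
Proof. by move=> ainj; apply: big_pred1 => i'; exact: inj_eq. Qed.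

Implicit Types N : nc_network R D.

Definition preactivation N l (j : 'I_(width N l.+1)) : E := fun x =>
  (weight N l *m
     layer_output sigma (castmx (esym (width_in N), erefl 1%N) x) l +
   bias N l) j 0.

(** The empty sum here and the zero coordinate weights in [preactivationSE] give all layers the
    common shape compared by [expansion_eq]. *)
Lemma preactivation0E N j x :
  preactivation (N := N) (l := 0) j x =
  bias N 0%N j 0 +
  \sum_k weight N 0%N j (cast_ord (esym (width_in N)) k) * x k 0 +
  \sum_(i : 'I_0) 0 * sigma (0 : R).
Proof.
rewrite /preactivation !mxE big_ord0 addr0 addrC; congr (_ + _).
rewrite (reindex (cast_ord (esym (width_in N)))) /=; last first.
  by apply: onW_bij; exists (cast_ord (width_in N)) => i; exact: val_inj.
apply: eq_bigr => k _; rewrite castmxE; congr (_ * x _ _); exact: val_inj.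
Qed.

Lemma preactivationSE N l j x :
  preactivation (N := N) (l := l.+1) j x =
  bias N l.+1 j 0 + \sum_(k < D) 0 * x k 0 +
  \sum_i weight N l.+1 j i * sigma (preactivation (N := N) (l := l) i x).
Proof.
rewrite [X in _ + X + _]big1 ?addr0 => [|k _]; last by rewrite mul0r.
rewrite {1}/preactivation !mxE addrC; congr (_ + _).
by apply: eq_bigr => i _; rewrite mxE.
Qed.

(** Expansions in the previous layer are unique because its preactivations are distinct. Hence a
    constant preactivation would have a zero row of weights, and two equal ones would be clones. *)
Lemma preactivation_props N l : (l < depth N)%N ->
  (forall j, preact_fun sigma (preactivation (N := N) (l := l) j)) /\
  injective (preactivation (N := N) (l := l)).
Proof.
elim: l => [|l IH] ld.
  have eqP0 j c (w : 'I_D -> R) (th : R) :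
     (forall x : 'cV[R]_D, preactivation (N := N) (l := 0) j x =
        th + \sum_k w k * x k 0 + \sum_(i : 'I_0) c * sigma 0) ->
     bias N 0%N j 0 = th /\
     forall k, weight N 0%N j (cast_ord (esym (width_in N)) k) = w k.
    move=> H; have [||| -> wE _] := @expansion_eq 'I_0 'I_0
        (fun=> fun=> 0) (fun=> fun=> 0) (fun=> 0) (fun=> c)
        (bias N 0%N j 0) th
        (fun k => weight N 0%N j (cast_ord (esym (width_in N)) k)) w => //.
    - by case.
    - by case.
    - by move=> x; rewrite -H preactivation0E.
  split=> [j|j j' jj'].
    apply: (preact_fun_lincomb (a := fun (i : 'I_0) (x : 'cV[R]_D) => 0)
       (k := fun=> 0)); first by case.
    - move=> c; apply: contrapT => /forallNP H.
      have [|_ wE] := eqP0 j 0 (fun=> 0) c.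
        move=> x; rewrite big_ord0 big1 => [|k _]; last by rewrite mul0r.
        by rewrite !addr0; apply: contrapT; exact: H.
      have := @weight_row_neq0 _ N 0 j ld; move/eqP; apply.
      apply/rowP => k; rewrite !mxE -(wE (cast_ord (width_in N) k)).
      by congr (weight N 0%N _ _); exact: val_inj.
    - exact: preactivation0E.
  apply/eqP/negP => /negP ne; apply: (@nc_no_clones _ _ N 0 j j' ld ne).
  have [|-> wE] := eqP0 j 0 (fun k => weight N 0%N j' (cast_ord (esym (width_in N)) k)) (bias N 0%N j' 0).
    by move=> x; rewrite jj' preactivation0E.
  congr (_, _); apply/rowP => k; rewrite !mxE.
  have := wE (cast_ord (width_in N) k).
  by have -> : cast_ord (esym (width_in N)) (cast_ord (width_in N) k) = k by exact: val_inj.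
have [aP ainj] := IH (ltnW ld).
have eqPS j th (w : 'I_D -> R) c :
   (forall x : 'cV[R]_D, preactivation (N := N) (l := l.+1) j x =
        th + \sum_k w k * x k 0 +
        \sum_i c i * sigma (preactivation (N := N) (l := l) i x)) ->
     bias N l.+1 j 0 = th /\ forall k, weight N l.+1 j k = c k.
  move=> H; have [||| -> _ cE] := @expansion_eq _ _
    (preactivation (N := N) (l := l)) (preactivation (N := N) (l := l))
    (fun k => weight N l.+1 j k) c (bias N l.+1 j 0) th (fun=> 0) w => //.
    by move=> x; rewrite -H preactivationSE.
  by split=> // k; have := cE (preactivation k); rewrite !sum_injective.
split=> [j|j j' jj'].
  apply: (preact_fun_lincomb (a := preactivation (N := N) (l := l))
       (k := fun k => weight N l.+1 j k)) => //.
  - move=> c; apply: contrapT => /forallNP H.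
    have [|_ wE] := eqPS j c (fun=> 0) (fun=> 0).
      move=> x; rewrite !big1 => [|k _|k _]; rewrite ?mul0r //.
      by rewrite !addr0; apply: contrapT; exact: H.
    have := @weight_row_neq0 _ N l.+1 j ld; move/eqP; apply.
    by apply/rowP => k; rewrite !mxE wE.
  - exact: preactivationSE.
apply/eqP/negP => /negP ne; apply: (@nc_no_clones _ _ N l.+1 j j' ld ne).
have [|-> wE] := eqPS j (bias N l.+1 j' 0) (fun=> 0) (fun k => weight N l.+1 j' k).
  by move=> x; rewrite jj' preactivationSE.
by congr (_, _); apply/rowP => k; rewrite !mxE.
Qed.

Definition layers_match N N' l l' : Prop :=
  forall j : 'I_(width N l.+1), exists j' : 'I_(width N' l'.+1),
    preactivation j = preactivation j'.

Lemma preactivationS_inj N N' l l' j j' :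
  (l.+1 < depth N)%N -> (l'.+1 < depth N')%N ->
  preactivation (N := N) (l := l.+1) j = preactivation (N := N') (l := l'.+1) j' ->
  bias N l.+1 j 0 = bias N' l'.+1 j' 0 /\
  forall f, \sum_(i | preactivation (N := N) (l := l) i == f) weight N l.+1 j i =
            \sum_(i | preactivation (N := N') (l := l') i == f) weight N' l'.+1 j' i.
Proof.
move=> ld l'd' jj'.
have [aP _] := preactivation_props (ltnW ld).
have [aP' _] := preactivation_props (ltnW l'd').
have [|-> _ cE] := @expansion_eq _ _ _ _
  (fun k => weight N l.+1 j k) (fun k => weight N' l'.+1 j' k)
  (bias N l.+1 j 0) (bias N' l'.+1 j' 0) (fun=> 0) (fun=> 0) aP aP' => //.
by move=> x; rewrite -!preactivationSE jj'.
Qed.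

(** A nonzero column means that unit [i] feeds some [j]. In the expansion of the partner of [j] the
    preactivation of [i] has the same nonzero coefficient, so it occurs among the units of [N']. *)
Lemma layers_match_pred N N' l l' :
  (l.+1 < depth N)%N -> (l'.+1 < depth N')%N ->
  layers_match N N' l.+1 l'.+1 -> layers_match N N' l l'.
Proof.
move=> ld l'd' H i.
have /existsP[j wji] : [exists j, weight N l.+1 j i != 0].
  have := @weight_col_neq0 _ N l.+1 i ld; apply: contraR => /existsPn E0.
  apply/eqP/colP => j; rewrite !mxE; apply/eqP; rewrite -[_ == _]negbK.
  exact: E0.
have [j' jj'] := H j; have [_ /(_ (preactivation i))] := preactivationS_inj ld l'd' jj'.
have [_ ainj] := preactivation_props (ltnW ld); rewrite sum_injective // => wE.
apply: contrapT => /forallNP no; move/eqP: wji; apply; rewrite wE big1 // => i' /eqP E0.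
by case: (no i').
Qed.

Lemma layers_match_down N N' l l' k :
  (l < depth N)%N -> (l' < depth N')%N -> (k <= l)%N -> (k <= l')%N ->
  layers_match N N' l l' -> layers_match N N' (l - k) (l' - k).
Proof.
move=> ld l'd' kl kl' H; elim: k kl kl' => [|k IH] kl kl'; first by rewrite !subn0.
have := IH (ltnW kl) (ltnW kl').
have -> : (l - k = (l - k.+1).+1)%N by rewrite -subSn // subSS.
have -> : (l' - k = (l' - k.+1).+1)%N by rewrite -subSn // subSS.
apply: layers_match_pred.
  by rewrite -subSn // subSS; apply: leq_ltn_trans ld; exact: leq_subr.
by rewrite -subSn // subSS; apply: leq_ltn_trans l'd'; exact: leq_subr.
Qed.

Lemma width_gt0 N l : (l <= depth N)%N -> (0 < width N l)%N.
Proof.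
move=> ld; apply: (@layout_gt0 _ N); apply: mem_nth.
have := depth_ge1 N; move: ld; rewrite /depth.
by case: size => //= n; rewrite ltnS.
Qed.

(** Otherwise descending would match the first layer of [N] with a later layer of [N']. A
    first-layer preactivation has nonzero coordinate weights, whereas in the expansion of a later
    one they vanish. *)
Lemma layers_match_depth N N' l l' :
  depth N = l.+1 -> depth N' = l'.+1 -> layers_match N N' l l' -> (l' <= l)%N.
Proof.
move=> dN dN' H; rewrite leqNgt; apply/negP => ll'.
have ld : (l < depth N)%N by rewrite dN.
have l'd' : (l' < depth N')%N by rewrite dN'.
have := layers_match_down ld l'd' (leqnn l) (ltnW ll') H; rewrite subnn.
move=> /(_ (Ordinal (width_gt0 (leq_ltn_trans (leq0n l) ld))))[j'].
have d0 : (0 < depth N)%N by rewrite dN.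
move: j'; have -> : (l' - l = (l' - l.+1).+1)%N by rewrite -subSn // subSS.
have l2 : ((l' - l.+1).+1 < depth N')%N.
  by rewrite -subSn // subSS; apply: leq_ltn_trans l'd'; exact: leq_subr.
move: (l' - l.+1)%N l2 => m md j' jj'; set j := Ordinal _ in jj'.
have [aP' _] := preactivation_props (ltnW md).
have [|||_ wE _] := @expansion_eq 'I_0 _ (fun=> fun=> 0) (preactivation (N := N') (l := m))
  (fun=> 0) (fun k => weight N' m.+1 j' k)
  (bias N 0%N j 0) (bias N' m.+1 j' 0)
  (fun k => weight N 0%N j (cast_ord (esym (width_in N)) k)) (fun=> 0) => //.
- by case.
- by move=> x; rewrite -preactivationSE -preactivation0E jj'.
have := @weight_row_neq0 _ N 0 j d0; move/eqP; apply.
apply/rowP => k; rewrite !mxE -[RHS](wE (cast_ord (width_in N) k)).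
by congr (weight N 0%N _ _); exact: val_inj.
Qed.

Lemma layers_match_width N N' l : (l < depth N)%N ->
  layers_match N N' l l -> (width N l.+1 <= width N' l.+1)%N.
Proof.
move=> ld H; have [_ ainj] := preactivation_props ld.
have [f Hf] := choice H; rewrite -[X in (X <= _)%N]card_ord -[X in (_ <= X)%N]card_ord.
by apply: (@leq_card _ _ f) => j1 j2 fE; apply: ainj; rewrite !Hf fE.
Qed.

Lemma ord_of1 n (i j : 'I_n) : n = 1%N -> i = j.
Proof. by move=> n1; subst n; rewrite !ord1. Qed.

(** Matching descends to all layers in both directions, which equates the widths. The matching maps
    are the permutations, and uniqueness of expansions equates biases and weights along them. *)
Lemma layers_match_isomorphic N N' L :
  depth N = L.+1 -> depth N' = L.+1 ->
  layers_match N N' L L -> layers_match N' N L L -> isomorphic N N'.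
Proof.
move=> dN dN' H H'.
have ld l : (l <= L)%N -> (l < depth N)%N by rewrite dN.
have ld' l : (l <= L)%N -> (l < depth N')%N by rewrite dN'.
have M l : (l <= L)%N -> layers_match N N' l l.
  move=> lL; rewrite -(subKn lL).
  by apply: layers_match_down; rewrite ?leq_subr // ?dN ?dN'.
have M' l : (l <= L)%N -> layers_match N' N l l.
  move=> lL; rewrite -(subKn lL).
  by apply: layers_match_down; rewrite ?leq_subr // ?dN ?dN'.
have eqD : layout N = layout N'.
  have sN : size (layout N) = L.+2.
    by have := dN; rewrite /depth; have := depth_ge1 N; case: size => //= n _ ->.
  have sN' : size (layout N') = L.+2.
    by have := dN'; rewrite /depth; have := depth_ge1 N'; case: size => //= n _ ->.
  apply: (@eq_from_nth _ 0%N); rewrite ?sN ?sN' // => -[_|l lL].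
    exact: etrans (width_in N) (esym (width_in N')).
  have {}lL : (l <= L)%N by [].
  apply/eqP; rewrite eqn_leq; apply/andP; split.
    exact: layers_match_width (ld _ lL) (M _ lL).
  exact: layers_match_width (ld' _ lL) (M' _ lL).
pose cast l : 'I_(width N l) -> 'I_(width N' l) :=
  cast_ord (congr1 (fun D => nth 0%N D l) eqD).
(* Index [l.+1] permutes the units whose preactivations are numbered [l]. The input layer gets the
   identity, and beyond the output layer the identity is a default. *)
have gammaP l : exists g : {perm 'I_(width N l)},
    match l return {perm 'I_(width N l)} -> Prop with
    | 0%N => fun g => g = 1%g
    | l'.+1 => fun g => (l' <= L)%N -> forall j,
        preactivation (N := N') (l := l') (cast l'.+1 j) = preactivation (g j)
    end g.
  case: l => [|l]; first by exists 1%g.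
  have [lL|_] := leqP l L; last by exists 1%g.
  have [h Hh] := choice (fun j => M' l lL (cast l.+1 j)).
  have hinj : injective h.
    have [_ ainj'] := preactivation_props (ld' _ lL).
    move=> j1 j2 hE; apply: (@cast_ord_inj _ _ (congr1 (fun D => nth 0%N D l.+1) eqD)).
    by apply: ainj'; rewrite -/(cast l.+1) !Hh hE.
  by exists (perm hinj) => _ j; rewrite permE.
pose gamma l := projT1 (cid (gammaP l)).
have gamma0 : gamma 0%N = 1%g by rewrite /gamma; case: cid.
have gammaS l j : (l <= L)%N ->
    preactivation (N := N') (l := l) (cast l.+1 j) = preactivation (gamma l.+1 j).
  by move=> lL; rewrite /gamma; case: cid => g /=; exact.
exists eqD, gamma; split=> //.
  by apply/permP => j; exact: ord_of1 (width_out N).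
rewrite dN => -[|l] lL j; have := gammaS _ j lL; rewrite -/(cast _).
  move=> jj'.
  have [|||bE wE _] := @expansion_eq 'I_0 'I_0
    (fun=> fun=> 0) (fun=> fun=> 0) (fun=> 0) (fun=> 0)
    (bias N' 0%N (cast _ j) 0) (bias N 0%N (gamma 1%N j) 0)
    (fun k => weight N' 0%N (cast _ j) (cast_ord (esym (width_in N')) k))
    (fun k => weight N 0%N (gamma 1%N j) (cast_ord (esym (width_in N)) k)).
  - by case.
  - by case.
  - by move=> x; rewrite -!preactivation0E jj'.
  split=> // k; rewrite gamma0 perm1.
  have := wE (cast_ord (width_in N) k).
  have -> : cast_ord (esym (width_in N)) (cast_ord (width_in N) k) = k by exact: val_inj.
  by move=> <-; congr (weight N' 0%N _ _); exact: val_inj.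
move=> jj'; have {}lL : (l.+1 <= L)%N by [].
have [bE wE] := preactivationS_inj (ld' l.+1 lL) (ld l.+1 lL) jj'.
split=> // k; have [_ ainj] := preactivation_props (ld _ (ltnW lL)).
have [_ ainj'] := preactivation_props (ld' _ (ltnW lL)).
have := wE (preactivation (N := N') (l := l) (cast l.+1 k)).
by rewrite sum_injective // (gammaS _ _ (ltnW lL)) sum_injective.
Qed.

Lemma nc_realizationE N : exists l (j : 'I_(width N l.+1)),
  depth N = l.+1 /\ forall x, nc_realization sigma N x = sigma (preactivation j x).
Proof.
have dE : depth N = (depth N).-1.+1 by rewrite prednK //; exact: depth_ge1.
exists (depth N).-1; rewrite /nc_realization /realization.
move: (depth N) (depth N).-1 (width_out N) dE => d l e dE; subst d.
exists (cast_ord (esym e) 0); split=> // x.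
by rewrite castmxE /= mxE; congr (sigma (_ _ _)); exact: val_inj.
Qed.

(** Equal output preactivations would match two last layers of one unit each and force an
    isomorphism. So the output preactivations are distinct, and every fibre is a singleton. *)
Theorem nc_realizations_independent n (N : 'I_n -> nc_network R D) :
  (forall i j, i != j -> ~ isomorphic (N i) (N j)) ->
  linearly_independent (with_one (fun j => nc_realization sigma (N j))).
Proof.
move=> noniso c c0.
have [l Hl] := choice (fun i => nc_realizationE (N i)).
have [j Hj] : {j : forall i, 'I_(width (N i) (l i).+1) | forall i,
    depth (N i) = (l i).+1 /\
    forall x, nc_realization sigma (N i) x = sigma (preactivation (j i) x)}.
  exists (fun i => projT1 (cid (Hl i))) => i; exact: (projT2 (cid (Hl i))).
have aP i : preact_fun sigma (preactivation (j i)).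
  have [d _] := Hj i.
  by have [] := @preactivation_props (N i) (l i) _; rewrite ?d.
have one_unit i (j' : 'I_(width (N i) (l i).+1)) : j' = j i.
  have [d _] := Hj i; have := width_out (N i); rewrite d => w1.
  exact: ord_of1 w1.
have ainj : injective (fun i => preactivation (j i)).
  move=> i i' ii'; apply/eqP/negP => /negP ne; apply: (noniso _ _ ne).
  have [d _] := Hj i; have [d' _] := Hj i'.
  have m : layers_match (N i) (N i') (l i) (l i').
    by move=> j'; exists (j i'); rewrite (one_unit i j').
  have m' : layers_match (N i') (N i) (l i') (l i).
    by move=> j'; exists (j i); rewrite (one_unit i' j').
  have ll' : l i = l i'.
    apply/eqP; rewrite eqn_leq (layers_match_depth d' d m') //.
    exact: layers_match_depth d d' m.
  move: d' m m'; rewrite -ll' => d' m m'.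
  exact: layers_match_isomorphic d d' m m'.
have [||c1 _ ck] := preact_independent sigma_lip sigma_gen
    (a := fun i => preactivation (j i)) (k := fun i => c (Some i))
    (th := c None) (w := fun=> 0).
- exact: aP.
- move=> x; have := congr1 (fun f => f x) c0.
  rewrite fct_sumE (bigD1 None) //= (reindex_omap Some id) /=; last by case.
  under eq_bigl do rewrite eqxx.
  rewrite [X in _ + X + _]big1 ?addr0 => [|k _]; last by rewrite mul0r.
  move=> H; apply: etrans H; congr (_ + _); first by rewrite -[LHS]mulr1.
  by apply: eq_bigr => i _; have [_ /(_ x) E0] := Hj i; rewrite -E0.
case=> [i|//].
by have := ck (preactivation (j i)); rewrite (sum_injective _ _ ainj).
Qed.

End Networks.

(** * Quantitative differentiability on a strip *)

(* A quantitative form of differentiability on [S]: unlike pointwise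
   differentiability, it survives uniform limits without any integration
   theory. *)
Definition C11 (K : numFieldType) (S : set K) (M : K) (f f' : K -> K) : Prop :=
  forall z, S z -> [/\ `|f z| <= M, `|f' z| <= M &
    forall h, S (z + h) -> `|f (z + h) - f z - h * f' z| <= M * `|h| ^+ 2].

Section C11Theory.
Context (K : numFieldType) (S : set K).
Implicit Types (M : K) (f g : K -> K).

(** Steps of length at most 1 use the derivative estimate, longer ones the bound [M] on both
    values. *)
Lemma C11_lipschitz M f f' z h : 0 <= M -> C11 S M f f' -> S z -> S (z + h) ->
  `|f (z + h) - f z| <= 2 * M * `|h|.
Proof.
move=> M0 fC Sz Szh; have [b1 b2 b3] := fC z Sz; have [b1' _ _] := fC _ Szh.
have [h1|/ltW h1] := real_leP (normr_real h) (real1 K).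
  rewrite -(subrK (h * f' z) (f (z + h) - f z)) (le_trans (ler_normD _ _)) //.
  have -> : 2 * M * `|h| = M * `|h| + M * `|h| by ring.
  apply: lerD; first by rewrite (le_trans (b3 h Szh)) // ler_wpM2l // expr2 ler_piMl.
  by rewrite normrM mulrC ler_wpM2r.
rewrite (le_trans (ler_normB _ _)) // (@le_trans _ _ (2 * M)) //.
  by rewrite mulr_natl mulr2n lerD.
by rewrite ler_peMr // mulr_ge0.
Qed.

Lemma C11_ext M f f' g g' : (forall z, S z -> f z = g z) ->
  (forall z, S z -> f' z = g' z) -> C11 S M f f' -> C11 S M g g'.
Proof.
move=> fg fg' fC z Sz; have [b1 b2 b3] := fC z Sz.
by split; rewrite -?fg -?fg' // => h Szh; rewrite -!fg -?fg' //; exact: b3.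
Qed.

Lemma C11_le M M' f f' : M <= M' -> C11 S M f f' -> C11 S M' f f'.
Proof.
move=> MM' fC z Sz; have [b1 b2 b3] := fC z Sz; split=> [||h Szh].
- exact: le_trans MM'.
- exact: le_trans MM'.
- by rewrite (le_trans (b3 h Szh)) // ler_wpM2r // exprn_ge0.
Qed.

Lemma C11_cst c : C11 S `|c| (fun=> c) (fun=> 0).
Proof.
move=> z Sz; rewrite normr0; split=> // h Szh.
by rewrite subrr mulr0 subrr normr0 mulr_ge0 // exprn_ge0.
Qed.

Lemma C11_0 : C11 S 0 (fun=> 0) (fun=> 0).
Proof. by have := C11_cst 0; rewrite normr0. Qed.

Lemma C11D M1 M2 f f' g g' : C11 S M1 f f' -> C11 S M2 g g' ->
  C11 S (M1 + M2) (fun z => f z + g z) (fun z => f' z + g' z).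
Proof.
move=> fC gC z Sz; have [b1 b2 b3] := fC z Sz; have [c1 c2 c3] := gC z Sz.
split=> [||h Szh]; [by rewrite (le_trans (ler_normD _ _)) // lerD..|].
have -> : f (z + h) + g (z + h) - (f z + g z) - h * (f' z + g' z) =
  (f (z + h) - f z - h * f' z) + (g (z + h) - g z - h * g' z) by ring.
by rewrite (le_trans (ler_normD _ _)) // mulrDl lerD ?b3 ?c3.
Qed.

Lemma C11Z c M f f' : C11 S M f f' ->
  C11 S (`|c| * M) (fun z => c * f z) (fun z => c * f' z).
Proof.
move=> fC z Sz; have [b1 b2 b3] := fC z Sz.
split=> [||h Szh]; [by rewrite normrM ler_wpM2l..|].
have -> : c * f (z + h) - c * f z - h * (c * f' z) =
   c * (f (z + h) - f z - h * f' z) by ring.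
by rewrite normrM -mulrA ler_wpM2l ?b3.
Qed.

Lemma C11M M1 M2 f f' g g' : 0 <= M1 -> 0 <= M2 ->
  C11 S M1 f f' -> C11 S M2 g g' ->
  C11 S (4 * (M1 * M2)) (fun z => f z * g z) (fun z => f' z * g z + f z * g' z).
Proof.
move=> M10 M20 fC gC z Sz; have [b1 b2 b3] := fC z Sz; have [c1 c2 c3] := gC z Sz.
have p0 : 0 <= M1 * M2 by exact: mulr_ge0.
have bound1 : `|f z * g z| <= M1 * M2 by rewrite normrM ler_pM.
have bound2 : `|f' z * g z + f z * g' z| <= 2 * (M1 * M2).
  by rewrite (le_trans (ler_normD _ _)) // !normrM mulr_natl mulr2n lerD // ler_pM.
split=> [||h Szh].
- by rewrite (le_trans bound1) // ler_peMl // ler1n.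
- by rewrite (le_trans bound2) // ler_wpM2r // ler_nat.
have -> : f (z + h) * g (z + h) - f z * g z - h * (f' z * g z + f z * g' z) =
  (f (z + h) - f z - h * f' z) * g (z + h) +
  h * f' z * (g (z + h) - g z) + f z * (g (z + h) - g z - h * g' z) by ring.
have [c1' _ _] := gC _ Szh; have gl := C11_lipschitz M20 gC Sz Szh.
apply: (@le_trans _ _ (M1 * `|h| ^+ 2 * M2 + `|h| * M1 * (2 * M2 * `|h|) +
   M1 * (M2 * `|h| ^+ 2))).
  rewrite (le_trans (ler_normD _ _)) // lerD //; last first.
    by rewrite normrM ler_pM ?c3.
  rewrite (le_trans (ler_normD _ _)) // lerD //.
    by rewrite normrM ler_pM ?b3.
  by rewrite !normrM ler_pM // ler_pM.
by rewrite le_eqVlt; apply/orP; left; apply/eqP; ring.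
Qed.

Lemma C11_sum (I : Type) (r : seq I) (M : I -> K) (f f' : I -> K -> K) :
  (forall i, C11 S (M i) (f i) (f' i)) ->
  C11 S (\sum_(i <- r) M i) (fun z => \sum_(i <- r) f i z)
    (fun z => \sum_(i <- r) f' i z).
Proof.
move=> fC; elim: r => [|i r IH].
  by rewrite big_nil; apply: (C11_ext _ _ C11_0) => z _; rewrite big_nil.
rewrite big_cons; apply: (C11_ext _ _ (C11D (fC i) IH)) => z _.
  by rewrite big_cons.
by rewrite big_cons.
Qed.

Definition C11_fun f : Prop := exists M f', 0 <= M /\ C11 S M f f'.

Lemma C11_fun_ext f g : (forall z, S z -> f z = g z) -> C11_fun f -> C11_fun g.
Proof. by move=> fg [M [f' [M0 fC]]]; exists M, f'; split=> //; exact: C11_ext fC. Qed.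

Lemma C11_funD f g : C11_fun f -> C11_fun g -> C11_fun (fun z => f z + g z).
Proof.
move=> [M1 [f' [M10 fC]]] [M2 [g' [M20 gC]]].
by exists (M1 + M2), (fun z => f' z + g' z); split; [exact: addr_ge0|exact: C11D].
Qed.

Lemma C11_funZ c f : C11_fun f -> C11_fun (fun z => c * f z).
Proof.
move=> [M [f' [M0 fC]]]; exists (`|c| * M), (fun z => c * f' z).
by split; [exact: mulr_ge0|exact: C11Z].
Qed.

Lemma C11_funM f g : C11_fun f -> C11_fun g -> C11_fun (fun z => f z * g z).
Proof.
move=> [M1 [f' [M10 fC]]] [M2 [g' [M20 gC]]].
exists (4 * (M1 * M2)), (fun z => f' z * g z + f z * g' z).
by split; [rewrite !mulr_ge0|exact: C11M].
Qed.

Lemma C11_funX f n : C11_fun f -> C11_fun (fun z => f z ^+ n).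
Proof.
move=> fC; elim: n => [|n IH].
  by exists `|1|, (fun=> 0); split=> //; exact: C11_cst.
by apply: (C11_fun_ext (f := fun z => f z * f z ^+ n)) => [z _|]; [rewrite exprS|exact: C11_funM].
Qed.

Lemma C11_fun_monomial c f g j k : C11_fun f -> C11_fun g ->
  C11_fun (fun z => (c * (f z + g z)) ^+ j * (f z * g z) ^+ k).
Proof.
move=> fC gC; apply: C11_funM; apply: C11_funX; last exact: C11_funM.
by apply: C11_funZ; exact: C11_funD.
Qed.

Lemma C11_funV a (d : K) : 0 < d -> (forall z, S z -> d <= `|z - a|) ->
  C11_fun (fun z => (z - a)^-1).
Proof.
move=> d0 Sd.
pose M := d^-1 + d^-1 ^+ 2 + d^-1 ^+ 3.
have i0 : 0 <= d^-1 by rewrite invr_ge0 ltW.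
have z0 z : S z -> z - a != 0 by move=> /Sd dz; rewrite -normr_gt0 (lt_le_trans d0).
have iz z : S z -> `|(z - a)^-1| <= d^-1.
  move=> Sz; rewrite normfV lef_pV2 ?posrE ?Sd //.
  by rewrite normr_gt0 z0.
exists M, (fun z => - (z - a)^-1 ^+ 2); split; first by rewrite !addr_ge0 ?exprn_ge0.
move=> z Sz; split=> [||h Szh].
- by rewrite (le_trans (iz z Sz)) // /M -addrA lerDl addr_ge0 ?exprn_ge0.
- rewrite normrN normrX (@le_trans _ _ (d^-1 ^+ 2)) //.
    by rewrite lerXn2r ?nnegrE ?iz.
  by rewrite /M addrAC lerDr addr_ge0 ?exprn_ge0.
have -> : (z + h - a)^-1 - (z - a)^-1 - h * - (z - a)^-1 ^+ 2 =
   (z - a)^-1 ^+ 2 * (z + h - a)^-1 * h ^+ 2.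
  by field; rewrite !z0.
rewrite normrM (normrX _ h) ler_wpM2r ?exprn_ge0 //.
rewrite normrM normrX (@le_trans _ _ (d^-1 ^+ 3)) //.
  by rewrite [leRHS]exprSr ler_pM ?exprn_ge0 ?iz // lerXn2r ?nnegrE ?iz.
by rewrite /M lerDr addr_ge0 ?exprn_ge0.
Qed.

End C11Theory.

Lemma half_sum_inv (K : numFieldType) (z a b : K) :
  a + b = 0 -> z - a != 0 -> z - b != 0 ->
  2^-1 * ((z - a)^-1 + (z - b)^-1) = z / ((z - a) * (z - b)).
Proof.
move=> /eqP; rewrite addrC addr_eq0 => /eqP -> za zb.
by field; rewrite za zb.
Qed.

Section Strip.
Context (R : realType).

Definition strip (c : R) : set R[i] := [set z | `|complex.Im z| < c].

Lemma normc_ge_Im (z : R[i]) : (`|complex.Im z|)%:C <= `|z|.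
Proof.
have := normc_ge_Re (z * 'i); rewrite ReiNIm normrN => /le_trans; apply.
by rewrite normrM [X in _ * X]normc_def /= expr0n expr1n add0r sqrtr1 mulr1.
Qed.

(** The function is the product of [(z / (1 + z^2)) ^ j] and [(1 / (1 + z^2)) ^ (n - j)]. By partial
    fractions both bases are made of the inverses of [z - i] and [z + i], and the strip stays at
    distance at least [1 / 2] from the points [i] and [- i]. *)
Lemma C11_fun_rat_basis (n j : nat) : (j <= n)%N ->
  C11_fun (strip (1 / 2)) (rat_basis n j).
Proof.
move=> jn.
have bd (a : R[i]) : `|complex.Im a| = 1 -> C11_fun (strip (1 / 2)) (fun z => (z - a)^-1).
  move=> a1; apply: (C11_funV (d := (1 / 2)%:C)); first by rewrite ltcR.
  move=> z; rewrite /strip /= => Sz; apply: le_trans (normc_ge_Im _).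
  rewrite lecR.
  have : `|complex.Im a| - `|complex.Im z| <= `|complex.Im (z - a)|.
    by case: z a {a1 Sz} => [z1 z2] [a1 a2] /=; rewrite distrC lerB_dist.
  rewrite a1; lra.
have p1 : C11_fun (strip (1 / 2)) (fun z => (z - 'i%C)^-1) by apply: bd; rewrite /= normr1.
have p2 : C11_fun (strip (1 / 2)) (fun z => (z - - 'i%C)^-1).
  by apply: bd; rewrite /= normrN normr1.
have sq1 : ('i%C : R[i]) ^+ 2 = -1 by rewrite sqr_i.
apply: (C11_fun_ext (f := fun z : R[i] =>
  (2^-1 * ((z - 'i%C)^-1 + (z - - 'i%C)^-1)) ^+ j *
  ((z - 'i%C)^-1 * (z - - 'i%C)^-1) ^+ (n - j))); last first.
  exact: (C11_fun_monomial _ _ _ p1 p2).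
move=> z Sz.
have ne (a : R[i]) : `|complex.Im a| = 1 -> z - a != 0.
  move=> a1; apply/eqP => /subr0_eq za; move: Sz; rewrite /strip /= za a1; lra.
have z1 := ne 'i%C; have z2 := ne (- 'i%C).
have {}z1 : z - 'i%C != 0 by apply: z1; rewrite /= normr1.
have {}z2 : z - - 'i%C != 0 by apply: z2; rewrite /= normrN normr1.
have zE : 1 + z ^+ 2 = (z - 'i%C) * (z - - 'i%C).
  by rewrite opprK -subr_sqr sq1 opprK addrC.
have -> : 2^-1 * ((z - 'i%C)^-1 + (z - - 'i%C)^-1) = z / (1 + z ^+ 2).
  by rewrite zE half_sum_inv // subrr.
rewrite -invfM -zE /rat_basis -(subnK jn) exprMn.
rewrite [in RHS]exprD [in RHS]invfM !exprVn addnK.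
by rewrite -mulrA [X in _ * X]mulrC.
Qed.

Lemma rat_basis_real n j (x : R) : rat_basis n j x%:C = (rat_basis n j x)%:C.
Proof.
rewrite /rat_basis fmorph_div !rmorphXn /=; congr (_ / _ ^+ _).
by rewrite rmorphD rmorph1 rmorphXn.
Qed.

Lemma normc_real (x : R) : `|x%:C| = (`|x|)%:C.
Proof. by rewrite normc_def /= expr0n addr0 sqrtr_sqr. Qed.

Lemma strip_real c (x : R) : 0 < c -> strip c x%:C.
Proof. by rewrite /strip /= normr0. Qed.

Lemma C11_real_lipschitz c (M : R) (f f' : R[i] -> R[i]) (fR : R -> R) :
  0 < c -> 0 <= M -> C11 (strip c) M%:C f f' -> (forall x : R, f x%:C = (fR x)%:C) ->
  forall x y, `|fR x - fR y| <= 2 * M * `|x - y|.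
Proof.
move=> c0 M0 fC fE x y.
have := @C11_lipschitz _ (strip c) M%:C f f' y%:C (x - y)%:C.
rewrite -rmorphD addrC subrK !fE -rmorphB /= !normc_real ler0c.
move=> /(_ M0 fC (strip_real y c0) (strip_real x c0)).
by rewrite -[2](rmorph_nat (real_complex R)) -!rmorphM /= lecR.
Qed.

End Strip.

(** * Uniform limits with explicit rates *)

Lemma nested_limit (R : realType) (a b : nat -> R) : (forall n, 0 <= b n) ->
  (forall n m, (n <= m)%N -> `|a m - a n| <= b n) ->
  exists l, forall n, `|l - a n| <= b n.
Proof.
move=> b0 ab.
have le_nm n m : a n - b n <= a m + b m.
  have [nm|/ltnW mn] := leqP n m.
    have := ab n m nm; rewrite ler_norml => /andP[]; have := b0 m; lra.
  have := ab m n mn; rewrite ler_norml => /andP[]; have := b0 n; lra.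
(* The limit is the supremum of the left ends of the intervals of centre [a n] and radius [b n], any
   two of which meet. *)
pose A := [set a n - b n | n in setT].
have A0 : A !=set0 by exists (a 0%N - b 0%N); exists 0%N.
have Aub m : ubound A (a m + b m) by move=> _ [n _ <-]; exact: le_nm.
exists (sup A) => n; rewrite ler_norml; apply/andP; split.
  have : a n - b n <= sup A.
    by apply: ub_le_sup; [exists (a 0%N + b 0%N); exact: Aub|exists n].
  lra.
have : sup A <= a n + b n by apply: ge_sup => //; exact: Aub.
lra.
Qed.

Lemma halving_limit_le (R : realType) (b : nat -> R) (r a c : R) :
  (forall n, b n.+1 <= b n / 2) -> 0 <= c ->
  (forall n, r <= a + c * b n) -> r <= a.
Proof.
move=> bh c0 H; rewrite leNgt; apply/negP => ar.
have bn n : b n <= `|b 0%N| / n.+1%:R.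
  apply: (@le_trans _ _ (`|b 0%N| / (2 ^ n)%:R)); last first.
    by rewrite ler_wpM2l // lef_pV2 ?posrE ?ltr0n ?expn_gt0 // ler_nat ltn_expl.
  elim: n => [|n IH]; first by rewrite expn0 divr1 ler_norm.
  rewrite (le_trans (bh n)) // expnS natrM invfM [2^-1 * _]mulrC mulrA ler_wpM2r //.
pose n := Num.truncn (c * `|b 0%N| / (r - a)).
have ra : 0 < r - a by rewrite subr_gt0.
have : c * `|b 0%N| / (r - a) < n.+1%:R by exact: truncnS_gt.
rewrite ltr_pdivrMr // => h1.
have h2 : c * b n <= c * (`|b 0%N| / n.+1%:R) by rewrite ler_wpM2l.
have h3 : c * (`|b 0%N| / n.+1%:R) < r - a.
  by rewrite mulrA ltr_pdivrMr ?ltr0n // [ltRHS]mulrC.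
have := le_lt_trans h2 h3; rewrite ltNge lerBlDl H //.
Qed.

Section ComplexLimit.
Context (R : realType).
Implicit Types (S : set R[i]) (b : nat -> R).

Lemma normc_le_ReIm (z : R[i]) :
  `|z| <= (`|complex.Re z| + `|complex.Im z|)%:C.
Proof.
rewrite {1}(complexE z) (le_trans (ler_normD _ _)) // rmorphD lerD //.
  by rewrite normc_real.
rewrite normrM normc_real [X in X * _]normc_def /= expr0n expr1n add0r sqrtr1.
by rewrite mul1r.
Qed.

Lemma complex_nested_limit (u : nat -> R[i]) b : (forall n, 0 <= b n) ->
  (forall n m, (n <= m)%N -> `|u m - u n| <= (b n)%:C) ->
  exists l, forall n, `|l - u n| <= (2 * b n)%:C.
Proof.
move=> b0 ub.
have [||l1 Hl1] := @nested_limit R (fun n => complex.Re (u n)) b => // [n m nm|].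
  have := le_trans (normc_ge_Re _) (ub n m nm); rewrite lecR.
  by case: (u m) (u n) => [? ?] [? ?].
have [||l2 Hl2] := @nested_limit R (fun n => complex.Im (u n)) b => // [n m nm|].
  have := le_trans (normc_ge_Im _) (ub n m nm); rewrite lecR.
  by case: (u m) (u n) => [? ?] [? ?].
exists (l1 +i* l2) => n; rewrite (le_trans (normc_le_ReIm _)) // lecR.
have := Hl1 n; have := Hl2 n; case: (u n) => [? ?] /=; lra.
Qed.

(** The estimates defining [C11] concern expressions linear in the pair of functions, so bounds on
    the increments add up and pass to the pointwise limit. *)
Lemma C11_limit S (F F' : nat -> R[i] -> R[i]) b :
  (forall n, 0 <= b n) -> (forall n, b n.+1 <= b n / 2) ->
  (forall z, F 0%N z = 0) -> (forall z, F' 0%N z = 0) ->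
  (forall n, C11 S (b n / 2)%:C (fun z => F n.+1 z - F n z)
     (fun z => F' n.+1 z - F' n z)) ->
  exists G G', C11 S (2 * b 0%N)%:C G G' /\
    forall n z, S z -> `|G z - F n z| <= (2 * b n)%:C.
Proof.
move=> b0 bh F0 F'0 FC.
(* Halving gives [b n / 2 <= b n - b n.+1], so the bounds on the increments telescope. *)
have tele n k : C11 S (b n - b (n + k)%N)%:C (fun z => F (n + k)%N z - F n z)
    (fun z => F' (n + k)%N z - F' n z).
  elim: k => [|k IH].
    rewrite addn0 subrr.
    by apply: (C11_ext _ _ (@C11_0 _ S)) => z _; rewrite subrr.
  apply: (@C11_le _ _ ((b n - b (n + k)%N)%:C + (b (n + k)%N / 2)%:C)).
    by rewrite -rmorphD lecR addnS; have := bh (n + k)%N; lra.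
  by apply: (C11_ext _ _ (C11D IH (FC (n + k)%N))) => z _; rewrite addnS; ring.
have tele' n m : (n <= m)%N ->
    C11 S (b n)%:C (fun z => F m z - F n z) (fun z => F' m z - F' n z).
  move=> nm; rewrite -(subnKC nm); apply: C11_le (tele n (m - n)%N).
  by rewrite lecR gerBl.
have /choice[G HG] : forall z, exists l, S z -> forall n, `|l - F n z| <= (2 * b n)%:C.
  move=> z; have [Sz|] := pselect (S z); last by exists 0.
  have [||l Hl] := @complex_nested_limit (fun n => F n z) b => // [n m nm|].
    by have [] := tele' n m nm z Sz.
  by exists l.
have /choice[G' HG'] : forall z, exists l, S z -> forall n, `|l - F' n z| <= (2 * b n)%:C.
  move=> z; have [Sz|] := pselect (S z); last by exists 0.
  have [||l Hl] := @complex_nested_limit (fun n => F' n z) b => // [n m nm|].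
    by have [] := tele' n m nm z Sz.
  by exists l.
exists G, G'; split; last by move=> n z Sz; exact: HG.
move=> z Sz; split=> [||h Szh].
- by have := HG z Sz 0%N; rewrite F0 subr0.
- by have := HG' z Sz 0%N; rewrite F'0 subr0.
set rem := _ - _ - _.
have remR : `|rem| = (complex.Re `|rem|)%:C by rewrite RRe_real // normr_real.
have hR : `|h| = (complex.Re `|h|)%:C by rewrite RRe_real // normr_real.
have h0 : 0 <= complex.Re `|h| by rewrite -ler0c -hR.
rewrite remR hR -rmorphXn -rmorphM lecR.
apply: (@le_trans _ _ (b 0%N * complex.Re `|h| ^+ 2)); last first.
  by rewrite ler_wpM2r ?exprn_ge0 // ler_peMl // ler1n.
(* The remainders of the limit and of [F n] differ by at most [(4 + 2 * |h|) * b n]: two values of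
   [F n] and [|h|] times one of [F' n], each off by at most [2 * b n]. *)
apply: (halving_limit_le (c := 4 + 2 * complex.Re `|h|) bh).
  by rewrite addr_ge0 // mulr_ge0.
move=> n; rewrite -lecR -remR.
have [_ _ /(_ h Szh)] := tele' 0%N n (leq0n n) z Sz.
rewrite !F0 !F'0 !subr0 => hF.
have -> : rem = (F n (z + h) - F n z - h * F' n z) + (G (z + h) - F n (z + h))
   - (G z - F n z) - h * (G' z - F' n z) by rewrite /rem; ring.
have -> : (b 0%N * complex.Re `|h| ^+ 2 + (4 + 2 * complex.Re `|h|) * b n)%:C =
   (b 0%N)%:C * `|h| ^+ 2 + (2 * b n)%:C + (2 * b n)%:C + `|h| * (2 * b n)%:C.
  by rewrite hR -rmorphXn -!rmorphM -!rmorphD /=; congr (_%:C); ring.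
apply: (le_trans (ler_normB _ _)); rewrite normrM lerD //; last first.
  by rewrite ler_wpM2l ?HG'.
apply: (le_trans (ler_normB _ _)); rewrite lerD ?HG //.
by apply: (le_trans (ler_normD _ _)); rewrite lerD ?HG.
Qed.

End ComplexLimit.

(** * Generic perturbations *)

Section GenericPerturbation.
Context (R : realType) (D : nat).

Local Notation S := (strip (1 / 2 : R)).

Definition real_on_line (F : R[i] -> R[i]) : Prop :=
  forall x : R, F x%:C = (complex.Re (F x%:C))%:C.

(** The code [k] names a system [(u, X)] with a level [l] that fixes a cube of parameters and a
    separation of the arguments. Every injective system falls under some level, and a code that
    decodes to nothing imposes no condition. *)
Definition avoids_below (s : R -> R) (b : R) (k : nat) : Prop :=
  forall u X l, unpickle k = Some (u, X, l) :> option (nat * seq (seq rat) * nat) ->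
  forall t : param_index D u (num_samples D u) -> R,
    cube l.+1%:R t ->
    (forall q q', q != q' -> l.+1%:R^-1 <= `|param_arg X t q - param_arg X t q'|) ->
    exists q, b < `|param_val X t q - s (param_arg X t q)|.

Lemma rat_basis_bounds n : exists (M : R) (g : 'I_n -> R[i] -> R[i]), 0 <= M /\
  forall j : 'I_n, C11 S M%:C (rat_basis n j) (g j).
Proof.
have /choice[Mg HMg] : forall j : 'I_n, exists Mg : R * (R[i] -> R[i]),
    0 <= Mg.1 /\ C11 S Mg.1%:C (rat_basis n j) Mg.2.
  move=> j; have [M [g [M0 gC]]] := @C11_fun_rat_basis R n j (ltnW (ltn_ord j)).
  have ME : M = (complex.Re M)%:C by rewrite RRe_real // ger0_real.
  by exists (complex.Re M, g); rewrite /= -ler0c -ME.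
exists (\sum_j (Mg j).1), (fun j => (Mg j).2); split.
  by rewrite sumr_ge0 // => j _; case: (HMg j).
move=> j; have [_ gC] := HMg j; apply: C11_le gC; rewrite lecR.
by rewrite (bigD1 j) //= lerDl sumr_ge0 // => i _; case: (HMg i).
Qed.

(** The number [b1] caps the later corrections: in the limit they amount to at most [2 * b1], so
    they cannot use up the margin gained against the system [k]. *)
Lemma perturbation_step (s0 : R -> R) (k : nat) (F F' : R[i] -> R[i]) (M b : R) :
  lipschitz_fun s0 -> 0 <= M -> C11 S M%:C F F' -> real_on_line F -> 0 < b ->
  exists F1 F1' b1, [/\
    C11 S (b / 2)%:C (fun z => F1 z - F z) (fun z => F1' z - F' z),
    real_on_line F1, 0 < b1, b1 <= b / 2 &
    avoids_below (fun x => s0 x + complex.Re (F1 x%:C)) (2 * b1) k].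
Proof.
move=> [L0 L00 s0L] M0 FC FR b0.
case E : (@unpickle (nat * seq (seq rat) * nat)%type k) => [[[u X] l]|]; last first.
  exists F, F', (b / 2); split=> //; last by rewrite /avoids_below E.
    apply: (@C11_le _ _ 0); first by rewrite ler0c divr_ge0 // ltW.
    by apply: (C11_ext _ _ (@C11_0 _ S)) => z _; rewrite subrr.
  by rewrite divr_gt0.
pose Q := ('I_(num_samples D u) * 'I_u.+1)%type.
pose n := #|{: Q}|.
have [B [g [B0 gC]]] := rat_basis_bounds n.
have nB : 0 < n%:R * B + 1 by rewrite ltr_wpDl // mulr_ge0.
(* The perturbation has [C11] constant at most [n * d * B], which this choice keeps below
   [b / 2]. *)
pose d := b / (2 * (n%:R * B + 1)).
have d0 : 0 < d by rewrite divr_gt0 // mulr_gt0.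
have half0 : 0 < 1 / 2 :> R by rewrite divr_gt0.
have fL x y : `|(s0 x + complex.Re (F x%:C)) - (s0 y + complex.Re (F y%:C))|
    <= (L0 + 2 * M) * `|x - y|.
  rewrite opprD addrACA (le_trans (ler_normD _ _)) // mulrDl lerD //.
  exact: (C11_real_lipschitz (fR := fun x => complex.Re (F x%:C)) half0 M0 FC FR).
have bL (j : 'I_#|{: Q}|) x y :
    `|rat_basis #|{: Q}| j x - rat_basis #|{: Q}| j y| <= 2 * B * `|x - y|.
  exact: (C11_real_lipschitz half0 B0 (gC j) (rat_basis_real _ _)).
have l0 : 0 < l.+1%:R :> R by rewrite ltr0n.
have [v vd [eta eta0 Heta]] := generic_step
  (card_param_index D u)
  (@locally_lipschitz_param_arg R D u _ X)
  (@locally_lipschitz_param_val R D u _ X) fL bL l0 d0.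
pose f z := \sum_(j < n) (v j)%:C * rat_basis n j z.
pose f' z := \sum_(j < n) (v j)%:C * g j z.
have fE (x : R) : f x%:C = (rat_sum v x)%:C.
  rewrite /f /rat_sum rmorph_sum; apply: eq_bigr => j _.
  by rewrite rat_basis_real -rmorphM.
exists (fun z => F z + f z), (fun z => F' z + f' z), (Num.min (b / 2) (eta / 4)).
have b10 : 0 < Num.min (b / 2) (eta / 4) by rewrite lt_min !divr_gt0.
have FE (x : R) : F x%:C + f x%:C = (complex.Re (F x%:C) + rat_sum v x)%:C.
  by rewrite fE FR /= -rmorphD.
split=> //.
- apply: (C11_ext (f := f) (f' := f')) => [z _|z _|]; [by rewrite addrC addKr..|].
  apply: C11_le (C11_sum (index_enum 'I_n) (fun j => C11Z (v j)%:C (gC j))).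
  apply: (@le_trans _ _ (\sum_(j < n) (d * B)%:C)).
    by apply: ler_sum => j _; rewrite normc_real -rmorphM lecR ler_wpM2r // vd.
  rewrite -rmorph_sum lecR sumr_const card_ord -[_ *+ n]mulr_natl.
  have -> : n%:R * (d * B) = b / 2 * ((n%:R * B) / (n%:R * B + 1)).
    by rewrite /d; field; rewrite gt_eqF.
  by rewrite ler_piMr ?divr_ge0 ?(ltW b0) // ler_pdivrMr // mul1r lerDl.
- by move=> x; rewrite FE.
- by rewrite ge_min lexx.
rewrite /avoids_below E => _ _ _ [<- <- <-] t tl tA.
have [q Hq] := Heta t tl tA; exists q; rewrite FE /= addrA.
have h4 : 2 * Num.min (b / 2) (eta / 4) <= eta.
  have : Num.min (b / 2) (eta / 4) <= eta / 4 by rewrite ge_min lexx orbT.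
  lra.
exact: le_lt_trans h4 Hq.
Qed.

(** Step [k] destroys the system coded by [k]; the limit is within [2 * b] of the function reached
    there, so it still violates that system. *)
Lemma generic_perturbation (s0 : R -> R) (eps : R) :
  lipschitz_fun s0 -> 0 < eps ->
  exists (G G' : R[i] -> R[i]) (M : R), [/\ 0 <= M, C11 S M%:C G G', real_on_line G,
    forall x : R, `|complex.Re (G x%:C)| <= eps &
    generic_fun D (fun x => s0 x + complex.Re (G x%:C))].
Proof.
move=> s0L eps0.
pose state := ((R[i] -> R[i]) * (R[i] -> R[i]) * R)%type.
pose inv (st : state) := [/\ exists2 M : R, 0 <= M & C11 S M%:C st.1.1 st.1.2,
  real_on_line st.1.1 & 0 < st.2].
pose next k (st st' : state) := [/\ inv st', st'.2 <= st.2 / 2,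
  C11 S (st.2 / 2)%:C (fun z => st'.1.1 z - st.1.1 z) (fun z => st'.1.2 z - st.1.2 z) &
  avoids_below (fun x => s0 x + complex.Re (st'.1.1 x%:C)) (2 * st'.2) k].
(* Where the invariant fails the state is left as it is, which makes the step a total function fit
   for plain recursion. *)
have stepP (p : nat * state) : exists st', inv p.2 -> next p.1 p.2 st'.
  case: p => k [[F F'] b] /=.
  have [[/= [M M0 FC] FR b0]|ninv] := pselect (inv (F, F', b)); last by exists (F, F', b).
  have [F1 [F1' [b1 [C1 R1 b10 b1b av]]]] := perturbation_step k s0L M0 FC FR b0.
  exists (F1, F1', b1) => _; split=> //; split=> //=.
  exists (M + b / 2); first by rewrite addr_ge0 // divr_ge0 // ltW.
  rewrite rmorphD; apply: (C11_ext _ _ (C11D FC C1)) => z _.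
    by rewrite addrC subrK.
  by rewrite addrC subrK.
have [g Hg] := choice stepP.
(* The initial budget is [eps / 2] because the limit is bounded by twice the budget. *)
pose st := fix st n : state :=
  if n is k.+1 then g (k, st k) else (fun=> 0, fun=> 0, eps / 2).
have st_inv n : inv (st n).
  elim: n => [|n IH]; last by have [] := Hg (n, st n) IH.
  split=> //=; last by rewrite divr_gt0.
  by exists 0 => //; exact: C11_0.
have st_next n : next n (st n) (st n.+1) by exact: (Hg (n, st n) (st_inv n)).
have [|||||G [G' [GC GF]]] := @C11_limit R S (fun n => (st n).1.1)
  (fun n => (st n).1.2) (fun n => (st n).2) => //.
- by move=> n; have [_ _ /ltW] := st_inv n.
- by move=> n; have [] := st_next n.
- by move=> n; have [] := st_next n.
have half0 : 0 < 1 / 2 :> R by rewrite divr_gt0.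
have e0 : 0 <= 2 * (eps / 2) by rewrite mulr_ge0 // divr_ge0 // ltW.
have bh n : (st n.+1).2 <= (st n).2 / 2 by have [] := st_next n.
have GR : real_on_line G.
  move=> x; have Sx := strip_real x half0.
  have im0 : complex.Im (G x%:C) = 0.
    apply/eqP; rewrite -normr_eq0 eq_le normr_ge0 andbT.
    apply: (halving_limit_le (c := 2) bh) => // n; rewrite add0r -lecR.
    apply: le_trans (GF n _ Sx).
    have [_ FR _] := st_inv n; rewrite FR.
    apply: le_trans (normc_ge_Im _); rewrite lecR.
    by case: (G _) => ? ? /=; rewrite subr0.
  by move: im0; case: (G _) => ? ? /= ->.
exists G, G', (2 * (eps / 2)); split=> //.
- move=> x; have := GF 0%N _ (strip_real x half0); rewrite subr0 GR normc_real lecR.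
  by rewrite /= mulrC divfK.
move=> u X t tinj.
pose A q := param_arg X t q.
(* Large enough to bound every coordinate and the inverse of every gap; the diagonal terms vanish
   because [0^-1 = 0]. *)
pose l := Num.truncn (\sum_i `|t i| + \sum_q \sum_q' `|A q - A q'|^-1).
have lE : \sum_i `|t i| + \sum_q \sum_q' `|A q - A q'|^-1 < l.+1%:R.
  exact: truncnS_gt.
have s10 : 0 <= \sum_i `|t i| by rewrite sumr_ge0.
have s20 q : 0 <= \sum_q' `|A q - A q'|^-1.
  by rewrite sumr_ge0 // => q' _; rewrite invr_ge0.
have tl : cube l.+1%:R t.
  move=> i; apply: le_trans (ltW lE); rewrite (bigD1 i) //= -addrA lerDl.
  by rewrite addr_ge0 ?sumr_ge0.
have tA q q' : q != q' -> l.+1%:R^-1 <= `|A q - A q'|.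
  move=> qq'; have Aqq' : 0 < `|A q - A q'|.
    rewrite normr_gt0 subr_eq0; apply: contra qq' => /eqP Aqq'.
    by apply/eqP; exact: tinj.
  rewrite -[leRHS]invrK lef_pV2 ?posrE ?ltr0n ?invr_gt0 //.
  apply: le_trans (ltW lE); apply: le_trans (_ : _ <= \sum_q \sum_q' `|A q - A q'|^-1) _.
    apply: (@le_trans _ _ (\sum_q' `|A q - A q'|^-1)).
      by rewrite (bigD1 q') //= lerDl sumr_ge0 // => i _; rewrite invr_ge0.
    by rewrite [leRHS](bigD1 q) //= lerDl sumr_ge0.
  by rewrite lerDr.
pose k := pickle (u, X, l).
have [_ _ _ /(_ u X l (pickleK _) t tl tA)[q Hq]] := st_next k.
exists q => Eq; move: Hq; apply/negP; rewrite -leNgt Eq opprD addrACA subrr add0r.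
have Sq := strip_real (A q) half0.
have [_ FR _] := st_inv k.+1.
have := GF k.+1 _ Sq; rewrite GR FR -rmorphB normc_real lecR.
done.
Qed.

End GenericPerturbation.

(** * Total variation and uniform continuity *)

Section RhoVariation.
Context (R : realType) (drho : R -> R).
Context (rhoL1 : (@lebesgue_measure R).-integrable setT (EFin \o drho)).

Local Notation mu := (@lebesgue_measure R).

(** Its increments will dominate those of [rho]; being bounded and monotone, it controls [rho] near
    infinity. *)
Definition abs_variation (x : R) : R :=
  fine (\int[mu]_(z in `]-oo, x]) `|(drho z)%:E|)%E.

Lemma mfun_abs_derive (A : set R) : measurable A ->
  measurable_fun A (abse \o (EFin \o drho)).
Proof.
move=> mA; apply: (@measurable_funS _ _ _ _ setT) => //.
by apply: measurableT_comp => //; exact: measurable_int rhoL1.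
Qed.

Lemma abs_derive_total_lty : (\int[mu]_z `|(drho z)%:E| < +oo)%E.
Proof. by have /integrableP[] := rhoL1. Qed.

Lemma abs_derive_fin (A : set R) : measurable A ->
  (\int[mu]_(z in A) `|(drho z)%:E|)%E \is a fin_num.
Proof.
move=> mA; rewrite ge0_fin_numE; last exact: integral_ge0.
apply: le_lt_trans abs_derive_total_lty.
apply: ge0_subset_integral => //; exact: mfun_abs_derive.
Qed.

Lemma abs_variation_ge0 x : 0 <= abs_variation x.
Proof. by apply: fine_ge0; exact: integral_ge0. Qed.

Lemma abs_variation_bounded x :
  abs_variation x <= fine (\int[mu]_z `|(drho z)%:E|)%E.
Proof.
apply: fine_le; rewrite ?abs_derive_fin //.
apply: ge0_subset_integral => //; exact: mfun_abs_derive.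
Qed.

Lemma abs_variationB x y : x < y ->
  abs_variation y - abs_variation x =
  fine (\int[mu]_(z in `]x, y[) `|(drho z)%:E|)%E.
Proof.
move=> xy; rewrite -(@integral_itv_bndoo _ _ _ _ false false); last exact: mfun_abs_derive.
rewrite /abs_variation (@itv_bndbnd_setU _ _ -oo%O (BRight x) (BRight y)) ?bnd_simp ?(ltW xy) //.
rewrite ge0_integral_setU //.
- by rewrite fineD ?abs_derive_fin // addrC addKr.
- by apply: mfun_abs_derive; exact: measurableU.
- apply/disj_setPS => z [/=]; rewrite !in_itv /= => zx /andP[xz _].
  by move: (lt_le_trans xz zx); rewrite ltxx.
Qed.

Context (rho : R -> R) (rhoc : continuous rho)
  (drhoE : forall x, rho^`() x = drho x).

(** The one-sided limits extend the derivative to a continuous [f] on [[a, b]], to which the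
    fundamental theorem of calculus applies; the integrals do not see the endpoints. *)
Lemma smooth_piece_variation (a b : R) : a < b ->
  (forall x, a < x < b -> derivable rho x 1 /\ {for x, continuous drho}) ->
  cvg (drho x @[x --> a^'+]) -> cvg (drho x @[x --> b^'-]) ->
  `|rho b - rho a| <= abs_variation b - abs_variation a.
Proof.
move=> ab dC ca cb.
set la := lim _ in ca; set lb := lim _ in cb.
pose f x := if x <= a then la else if b <= x then lb else drho x.
have fE x : a < x < b -> f x = drho x.
  by move=> /andP[ax xb]; rewrite /f leNgt ax leNgt xb.
have fc : {within `[a, b], continuous f}.
  apply/continuous_within_itvP => //; split.
  - move=> x; rewrite in_itv /= => xab; have [_ cx] := dC x xab.
    have fx : f x = drho x by exact: fE.
    rewrite /continuous_at fx; apply: cvg_trans cx; apply: near_eq_cvg.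
    near=> y; apply/esym/fE; apply/andP; split; near: y.
      by apply: lt_nbhsr; case/andP: xab.
    by apply: lt_nbhsl; case/andP: xab.
  - have -> : f a = la by rewrite /f lexx.
    apply: cvg_trans ca; apply: near_eq_cvg; near=> y; apply/esym/fE.
    by apply/andP; split; near: y; [exact: nbhs_right_gt|exact: nbhs_right_lt].
  - have -> : f b = lb by rewrite /f leNgt ab lexx.
    apply: cvg_trans cb; apply: near_eq_cvg; near=> y; apply/esym/fE.
    by apply/andP; split; near: y; [exact: nbhs_left_gt|exact: nbhs_left_lt].
have rhoLR : derivable_oo_LRcontinuous rho a b.
  split.
  - by move=> x; rewrite in_itv /= => /dC[].
  - by apply: cvg_at_right_filter; exact: rhoc.
  - by apply: cvg_at_left_filter; exact: rhoc.
have FTC : (\int[mu]_(x in `[a, b]) (f x)%:E = (rho b)%:E - (rho a)%:E)%E.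
  by apply: continuous_FTC2 => // x; rewrite in_itv /= => xab; rewrite fE // drhoE.
have mf : measurable_fun `[a, b] (EFin \o f).
  apply/measurable_EFinP; exact: subspace_continuous_measurable_fun.
rewrite -lee_fin abs_variationB // fineK ?abs_derive_fin //.
have -> : (`|rho b - rho a|%:E = `|(rho b)%:E - (rho a)%:E|)%E by [].
rewrite -FTC (le_trans (le_abse_integral mu _ mf)) //.
rewrite (@integral_itv_bndoo _ _ _ _ true false); last first.
  apply: (@measurable_funS _ _ _ _ `[a, b]%classic) => //.
    exact: subset_itv_oo_cc.
  exact: measurableT_comp mf.
apply: ge0_le_integral => //.
- apply: (@measurable_funS _ _ _ _ `[a, b]%classic) => //.
    exact: subset_itv_oo_cc.
  exact: measurableT_comp mf.
- exact: mfun_abs_derive.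
- by move=> x; rewrite /= in_itv /= => xab; rewrite fE.
Unshelve. all: by end_near. Qed.
End RhoVariation.

Section UniformContinuity.
Context (R : realType) (rho : R -> R).
Context (rhoC1 : piecewise_C1 rho)
  (rhoL1 : (@lebesgue_measure R).-integrable setT (EFin \o rho^`())).

Local Notation V := (abs_variation rho^`()).

(** Induction on a list containing the breakpoints inside the interval, splitting at each one. The
    endpoints may be breakpoints themselves, which is why the smooth case asks only for one-sided
    limits. *)
Lemma variation_bound (x y : R) : x <= y -> `|rho y - rho x| <= V y - V x.
Proof.
rewrite le_eqVlt => /orP[/eqP ->|]; first by rewrite !subrr normr0.
have [rhoc [S [Sfin Sreg Sbrk]]] := rhoC1.
have split_at a p b : `|rho p - rho a| <= V p - V a ->
    `|rho b - rho p| <= V b - V p -> `|rho b - rho a| <= V b - V a.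
  move=> h1 h2; have -> : rho b - rho a = (rho b - rho p) + (rho p - rho a) by ring.
  by rewrite (le_trans (ler_normD _ _)) // (le_trans (lerD h2 h1)) //; lra.
suff H (s : seq R) a b : a < b -> (forall p, S p -> a < p < b -> p \in s) ->
    `|rho b - rho a| <= V b - V a.
  move=> xy; have /finite_seqP[s sE] := Sfin x y.
  apply: (H s) => // p Sp /andP[xp py].
  have : (S `&` `[x, y]) p by split=> //=; rewrite in_itv /= !ltW.
  by rewrite sE.
elim: s a b => [|p s IH] a b ab sP.
  have reg z : a < z < b -> derivable rho z 1 /\ {for z, continuous rho^`()}.
    by move=> zab; apply: Sreg => Sz; have := sP z Sz zab; rewrite in_nil.
  apply: (smooth_piece_variation rhoL1) => //.
    have [/Sbrk[] //|/Sreg[_ c]] := pselect (S a).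
    by apply/cvg_ex; exists (rho^`() a); apply: cvg_at_right_filter; exact: c.
  have [/Sbrk[] //|/Sreg[_ c]] := pselect (S b).
  by apply/cvg_ex; exists (rho^`() b); apply: cvg_at_left_filter; exact: c.
have [/andP[ap pb]|npab] := boolP (a < p < b).
  apply: (split_at _ p).
    apply: IH => // q Sq /andP[aq qp].
    have := sP q Sq; rewrite aq (lt_trans qp pb) in_cons (lt_eqF qp) /=; exact.
  apply: IH => // q Sq /andP[pq qb].
  have := sP q Sq; rewrite (lt_trans ap pq) qb in_cons (gt_eqF pq) /=; exact.
apply: IH => // q Sq qab; have := sP q Sq qab; rewrite in_cons => /orP[/eqP E|//].
by move: npab; rewrite -E qab.
Qed.

Lemma variation_le x y : x <= y -> V x <= V y.
Proof. by move=> /variation_bound /(le_trans (normr_ge0 _)); rewrite subr_ge0. Qed.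

(** The monotone function [V] comes within [e] of its supremum and of its infimum, so beyond these
    points it varies by at most [e]. *)
Lemma small_tails (e : R) : 0 < e -> exists2 T : R, 0 < T &
  (forall x y, T <= x -> T <= y -> `|rho x - rho y| <= e) /\
  (forall x y, x <= - T -> y <= - T -> `|rho x - rho y| <= e).
Proof.
move=> e0; pose A := range V.
have A0 : A !=set0 by exists (V 0); exists 0.
have hs : has_sup A.
  split=> //; exists (fine (\int[@lebesgue_measure R]_z `|(rho^`()%classic z)%:E|)%E).
  by move=> _ [x _ <-]; exact: abs_variation_bounded.
have hi : has_inf A by split=> //; exists 0 => _ [x _ <-]; exact: abs_variation_ge0.
have [_ [a _ <-] aP] := sup_adherent e0 hs; have [_ [b _ <-] bP] := inf_adherent e0 hi.
have Vs x : V x <= sup A by apply: ub_le_sup; [case: hs|exists x].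
have Vi x : inf A <= V x by apply: ge_inf; [case: hi|exists x].
exists (`|a| + `|b| + 1); first by rewrite ltr_wpDl // addr_ge0.
have aT := ler_norm a; have bT := ler_norm (- b); rewrite normrN in bT.
have a0 := normr_ge0 a; have b0 := normr_ge0 b.
have top x y : x <= y -> a <= x -> `|rho y - rho x| <= e.
  move=> xy ax; rewrite (le_trans (variation_bound xy)) //.
  have := Vs y; have := variation_le ax; lra.
have bot x y : x <= y -> y <= b -> `|rho y - rho x| <= e.
  move=> xy yb; rewrite (le_trans (variation_bound xy)) //.
  have := Vi x; have := variation_le yb; lra.
split=> x y hx hy.
  have [xy|/ltW yx] := leP x y; first by rewrite distrC; apply: top => //; lra.
  by apply: top => //; lra.
have [xy|/ltW yx] := leP x y; first by rewrite distrC; apply: bot => //; lra.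
by apply: bot => //; lra.
Qed.

(** Heine's theorem with only [x] confined to the segment, so that pairs straddling an endpoint are
    covered. *)
Lemma uniformly_continuous_segment (a b e : R) : 0 < e -> exists2 d : R, 0 < d &
  forall x y, a <= x <= b -> `|y - x| < d -> `|rho y - rho x| <= e.
Proof.
move=> e0; have [rhoc _] := rhoC1.
have /compact_near_coveringP/(_ _ (0^'+ : set_system R)
    (fun d x => forall y, `|y - x| < d -> `|rho y - rho x| <= e)) H :=
  @segment_compact R a b.
have : \forall d \near 0^'+, `[a, b] `<=` (fun x => forall y, `|y - x| < d -> `|rho y - rho x| <= e).
  apply: H => x _.
  have e2 : 0 < e / 2 by rewrite divr_gt0.
  have := rhoc x; move=> /cvgrPdist_lt/(_ _ e2)/nbhs_ballP[d /= d0 Hd].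
  have Hd' y : `|y - x| < d -> `|rho x - rho y| < e / 2.
    by move=> yx; apply: Hd; rewrite /ball /= distrC.
  have d2 : 0 < d / 2 by rewrite divr_gt0.
  exists (ball x (d / 2), [set r | r < d / 2]).
    by split=> /=; [exact: nbhsx_ballx|exact: nbhs_right_lt].
  move=> [x' r] /= [xx' rd] y yx'.
  have h1 : `|x' - x| < d / 2 by move: xx'; rewrite /ball /= distrC.
  have h2 : `|y - x| < d.
    have -> : y - x = (y - x') + (x' - x) by ring.
    by rewrite (le_lt_trans (ler_normD _ _)) // [ltRHS](splitr d) ltrD // (lt_trans yx').
  have h3 := Hd' _ h2; have h4 : `|rho x - rho x'| < e / 2.
    by apply: Hd'; rewrite (lt_trans h1) // [ltRHS](splitr d) ltrDl.
  have -> : rho y - rho x' = (rho x - rho x') - (rho x - rho y) by ring.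
  by rewrite (le_trans (ler_normB _ _)) // [leRHS](splitr e) ltW // ltrD.
move=> nearH; near (0 : R)^'+ => d.
have Hd : `[a, b] `<=` (fun x => forall y, `|y - x| < d -> `|rho y - rho x| <= e).
  by near: d.
exists d; first by near: d; exact: nbhs_right_gt.
by move=> x y xab; apply: (Hd x); rewrite /= in_itv.
Unshelve. all: by end_near. Qed.

Lemma uniformly_continuous_line (e : R) : 0 < e -> exists2 g : R, 0 < g &
  forall x y, `|y - x| <= g -> `|rho y - rho x| <= e.
Proof.
move=> e0; have [T T0 [top bot]] := small_tails e0.
(* The extra 1 keeps [y] in the same tail as an [x] outside the segment, since steps will have
   length at most 1. *)
have [d d0 Hd] := uniformly_continuous_segment (- (T + 1)) (T + 1) e0.
exists (Num.min (d / 2) 1); first by rewrite lt_min ltr01 divr_gt0.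
move=> x y; rewrite le_min => /andP[yd]; rewrite ler_norml => /andP[y1 y2].
have [xT|xT] := ltP (T + 1) x; first by apply: top; lra.
have [xT'|xT'] := ltP x (- (T + 1)); first by apply: bot; lra.
apply: Hd; first by rewrite xT xT'.
by rewrite (le_lt_trans yd) // ltr_pdivrMr // ltr_pMr // ltr1n.
Qed.

End UniformContinuity.

(** * Smoothed steps: an algebraic sigmoid tending to the unit step as [d] tends to 0 *)

Definition soft_step (R : realType) (d y : R) : R :=
  (1 + y / Num.sqrt (d ^+ 2 + y ^+ 2)) / 2.

Section SoftStep.
Context (R : realType) (d : R) (d0 : 0 < d).
Local Notation s y := (Num.sqrt (d ^+ 2 + y ^+ 2)).

Let s2 y : s y ^+ 2 = d ^+ 2 + y ^+ 2.
Proof. by rewrite sqr_sqrtr // addr_ge0 ?sqr_ge0. Qed.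

Let s_ge_d y : d <= s y.
Proof. by rewrite -(ler_pXn2r (n := 2)) ?nnegrE ?sqrtr_ge0 ?(ltW d0) // s2 lerDl sqr_ge0. Qed.

Let s_gt0 y : 0 < s y.
Proof. exact: lt_le_trans (s_ge_d y). Qed.

Let s_ge_norm y : `|y| <= s y.
Proof.
rewrite -(ler_pXn2r (n := 2)) ?nnegrE ?sqrtr_ge0 // s2 real_normK ?num_real //.
by rewrite lerDr sqr_ge0.
Qed.

Let s_le y : s y <= `|y| + d.
Proof.
rewrite -(ler_pXn2r (n := 2)) ?nnegrE ?sqrtr_ge0 ?addr_ge0 ?(ltW d0) // s2.
rewrite sqrrD real_normK ?num_real //.
have : 0 <= `|y| * d by rewrite mulr_ge0 // ltW.
lra.
Qed.

Lemma soft_step_itv y : 0 <= soft_step d y <= 1.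
Proof.
have : `|y / s y| <= 1.
  by rewrite normrM normfV (gtr0_norm (s_gt0 y)) ler_pdivrMr // mul1r.
rewrite /soft_step; set q := y / _; rewrite ler_norml => /andP[h1 h2].
by apply/andP; split; lra.
Qed.

(** The root exceeds [|y|] by at most [d], so the ratio differs from the sign of [y] by at most
    [d / |y|]. *)
Lemma soft_step_far (g y : R) : 0 < g -> g <= `|y| ->
  `|soft_step d y - (0 <= y)%R%:R| <= d / g.
Proof.
move=> g0 gy.
have h : (s y - `|y|) / s y <= d / g.
  rewrite ler_pM ?invr_ge0 ?subr_ge0 ?(ltW (s_gt0 y)) //.
    by rewrite lerBlDl.
  by rewrite lef_pV2 ?posrE // (le_trans gy).
have h0 : 0 <= (s y - `|y|) / s y by rewrite divr_ge0 ?subr_ge0 // ltW.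
have E : (s y - `|y|) / s y = 1 - `|y| / s y.
  by rewrite mulrBl divff // gt_eqF.
rewrite /soft_step; move: h h0; rewrite E; case: (ger0P y) => y0.
  rewrite mulr1n; set q := y / _ => h h0.
  by rewrite ler_norml; apply/andP; split; lra.
rewrite mulr0n mulNr; set q := y / _ => h h0.
by rewrite ler_norml; apply/andP; split; lra.
Qed.

Lemma soft_step_lipschitz x y : `|soft_step d x - soft_step d y| <= d^-1 * `|x - y|.
Proof.
have sx := s_gt0 x; have sy := s_gt0 y.
have ss : `|s y - s x| <= `|x - y|.
  have E : (s y - s x) * (s y + s x) = (y - x) * (y + x).
    have := s2 x; have := s2 y; rewrite -!subr_sqr; lra.
  rewrite -(ler_pM2r (addr_gt0 sy sx)) -[X in _ * X <= _]gtr0_norm ?addr_gt0 //.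
  rewrite -normrM E normrM distrC ler_wpM2l //.
  by rewrite (le_trans (ler_normD _ _)) // lerD.
have E : soft_step d x - soft_step d y =
    2^-1 * ((x - y) / s x + y / s y * ((s y - s x) / s x)).
  by rewrite /soft_step; field; rewrite !gt_eqF.
rewrite E normrM gtr0_norm ?invr_gt0 //.
have h1 : `|(x - y) / s x| <= d^-1 * `|x - y|.
  rewrite normrM mulrC ler_wpM2r // normfV gtr0_norm // lef_pV2 ?posrE //.
have h2 : `|y / s y * ((s y - s x) / s x)| <= d^-1 * `|x - y|.
  rewrite normrM -[leRHS]mul1r ler_pM //.
    by rewrite normrM normfV (gtr0_norm sy) ler_pdivrMr // mul1r.
  rewrite normrM mulrC ler_pM // normfV gtr0_norm // lef_pV2 ?posrE //.
rewrite ler_pdivrMl // (le_trans (ler_normD _ _)) // mulr_natl mulr2n lerD //.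
Qed.

End SoftStep.

(** * Approximation by smoothed steps *)

Lemma sum_succ_eq_le1 (R : numDomainType) (K m : nat) :
  \sum_(k < K) (k.+1 == m)%:R <= 1 :> R.
Proof.
rewrite -natr_sum (ler_nat _ _ 1).
suff -> : (\sum_(k < K) (k.+1 == m) = (0 < m <= K))%N by case: (_ && _).
elim: K => [|K IH]; first by rewrite big_ord0; case: m.
rewrite big_ord_recr /= IH eq_sym.
by case: m {IH} => // m; rewrite !ltnS eqSS; case: (ltngtP m K).
Qed.

Section StepApproximation.
Context (R : realType) (rho : R -> R).
Context (rhoC1 : piecewise_C1 rho)
  (rhoL1 : (@lebesgue_measure R).-integrable setT (EFin \o rho^`())).

(** With sharp steps the sum telescopes to the value at the last node at or before [x]. The
    alternatives [j = 0] and [j = K] leave room for [x] outside the grid. *)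
Lemma sharp_step_value (t : nat -> R) (K : nat) (x : R) :
  {homo t : i j / (i <= j)%N >-> i <= j} ->
  exists j, [/\ (j <= K)%N, rho (t 0%N) +
     \sum_(k < K) (rho (t k.+1) - rho (t k)) * (t k.+1 <= x)%R%:R = rho (t j),
     j = 0%N \/ t j <= x & j = K \/ x < t j.+1].
Proof.
move=> th; elim: K => [|K [j [jK jE j0 jx]]].
  by exists 0%N; rewrite big_ord0 addr0; split=> //; left.
rewrite big_ord_recr /= addrA jE; have [tx|xt] := leP (t K.+1) x.
  have jK' : j = K.
    case: jx => // xj; have := lt_le_trans xj (th j.+1 K.+1 jK).
    by rewrite ltNge tx.
  exists K.+1; split=> //; [|by right|by left].
  by rewrite mulr1n mulr1 jK' addrC subrK.
exists j; rewrite mulr0n mulr0 addr0; split=> //; first exact: leqW.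
by right; case: jx => // ->.
Qed.

(** Sharp steps cost one [e], smoothing at most [3 * e]: the nodes at distance at least [g] from [x]
    contribute at most [e] together, and the at most two nearer ones at most [e] each. *)
Lemma soft_step_approximation (eps : R) : 0 < eps ->
  exists n d c0 (c t : 'I_n -> R), [/\ 0 < d, d <= 1 &
    forall x, `|rho x - (c0 + \sum_k c k * soft_step d (x - t k))| <= eps].
Proof.
move=> eps0; pose e := eps / 4; have e0 : 0 < e by rewrite divr_gt0.
have [T T0 [top bot]] := small_tails rhoC1 rhoL1 e0.
have [g g0 Hg] := uniformly_continuous_line rhoC1 rhoL1 e0.
pose K := (Num.truncn (2 * T / g)).+1.
have KT : 2 * T < K%:R * g by rewrite -ltr_pdivrMr // truncnS_gt.
(* Then [d / g <= 1 / (K + 1)], so the [K] far errors sum to at most 1. *)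
pose d := Num.min 1 (g / K.+1%:R).
have d0 : 0 < d by rewrite lt_min ltr01 divr_gt0.
pose t k := - T + k%:R * g.
have tS k : t k.+1 - t k = g by rewrite /t -natr1; ring.
have th : {homo t : i j / (i <= j)%N >-> i <= j}.
  by move=> i j ij; rewrite /t lerD2l ler_wpM2r ?(ltW g0) // ler_nat.
have dt k : `|rho (t k.+1) - rho (t k)| <= e by apply: Hg; rewrite tS gtr0_norm.
exists K, d, (rho (t 0%N)), (fun k => rho (t k.+1) - rho (t k)), (fun k => t k.+1).
split=> // [|x]; first by rewrite ge_min lexx.
have [j [jK jE j0 jx]] := sharp_step_value K x th.
have h1 : `|rho x - rho (t j)| <= e.
  case: jx => [jK'|xj].
    case: j0 => [j0|tx]; first by rewrite j0 in jK'.
    have Tt : T <= t j by rewrite jK' /t; lra.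
    by apply: top => //; exact: le_trans tx.
  case: j0 => [j0|tx].
    have [xT|xT] := leP x (- T); first by apply: bot => //; rewrite j0 /t mul0r addr0.
    apply: Hg; rewrite j0 /t mul0r addr0 gtr0_norm ?subr_gt0 //.
    by move: xj; rewrite j0 /t mul1r => /ltW; lra.
  by apply: Hg; rewrite ger0_norm ?subr_ge0 // -(tS j) lerD2r ltW.
pose E (k : 'I_K) := soft_step d (x - t k.+1) - (t k.+1 <= x)%R%:R.
(* Only the nodes of index [m] and [m.+1] can be closer than [g] to [x]. *)
pose m := Num.truncn ((x + T) / g).
have EE k : `|E k| <= K.+1%:R^-1 + (k.+1 == m)%:R + (k.+1 == m.+1)%:R.
  have K0 : 0 <= K.+1%:R^-1 :> R by rewrite invr_ge0.
  have [gx|xg] := leP g `|x - t k.+1|.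
    rewrite -addrA ler_wpDr ?addr_ge0 ?ler0n //.
    have := soft_step_far d0 g0 gx; rewrite subr_ge0 => /le_trans; apply.
    by rewrite ler_pdivrMr // ge_min mulrC lexx orbT.
  have E1 : `|E k| <= 1.
    have /andP[s0 s1] := soft_step_itv d0 (x - t k.+1).
    rewrite /E ler_norml; case: (t k.+1 <= x); rewrite ?mulr1n ?mulr0n;
      by apply/andP; split; lra.
  have y0 : 0 <= (x + T) / g.
    rewrite divr_ge0 ?(ltW g0) //; move: xg; rewrite ltr_norml /t => /andP[+ _].
    have : g <= k.+1%:R * g by rewrite ler_peMl ?(ltW g0) // ler1n.
    lra.
  have /andP[m1 m2] := truncn_itv y0; rewrite -/m in m1 m2.
  move: xg; rewrite ltr_norml /t => /andP[x1 x2].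
  have {}m1 : m%:R * g <= x + T by rewrite -ler_pdivlMr.
  have {}m2 : x + T < m.+1%:R * g by rewrite -ltr_pdivrMr.
  have a1 : (m < k.+2)%N.
    rewrite -(ltr_nat R) -(ltr_pM2r g0) -[k.+2%:R]natr1 mulrDl mul1r; lra.
  have a2 : (k.+1 < m.+2)%N.
    rewrite -(ltr_nat R) -(ltr_pM2r g0) -[m.+2%:R]natr1 mulrDl mul1r; lra.
  have : (k.+1 == m) || (k.+1 == m.+1).
    case: eqVneq => //= km; move: a1 a2; rewrite !ltnS leq_eqVlt eq_sym (negbTE km) /=.
    by rewrite ltnS eqSS eqn_leq => -> ->.
  move=> km; apply: (le_trans E1); case/orP: km => /eqP ->; rewrite eqxx mulr1n.
    by rewrite -addrA addrCA ler_wpDr // addr_ge0 ?ler0n.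
  by rewrite lerDr addr_ge0 ?ler0n.
have h2 : `|\sum_(k < K) (rho (t k.+1) - rho (t k)) * E k| <= e * 3.
  rewrite (le_trans (ler_norm_sum _ _ _)) //.
  apply: (@le_trans _ _ (\sum_(k < K) e * `|E k|)).
    by apply: ler_sum => k _; rewrite normrM ler_wpM2r.
  rewrite -mulr_sumr ler_wpM2l ?(ltW e0) //.
  apply: le_trans (ler_sum _ (fun k _ => EE k)) _.
  rewrite !big_split /= sumr_const card_ord.
  have K1 : K.+1%:R^-1 *+ K <= 1 :> R.
    by rewrite -[_ *+ K]mulr_natl ler_pdivrMr ?ltr0n // mul1r ler_nat.
  apply: le_trans (lerD (lerD K1 (sum_succ_eq_le1 R K m)) (sum_succ_eq_le1 R K m.+1)) _.
  lra.
have -> : rho x - (rho (t 0%N) + \sum_(k < K) (rho (t k.+1) - rho (t k)) *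
      soft_step d (x - t k.+1)) =
    (rho x - rho (t j)) - \sum_(k < K) (rho (t k.+1) - rho (t k)) * E k.
  rewrite -jE /E; under [X in _ = _ - X]eq_bigr do rewrite mulrBr.
  by rewrite sumrB; ring.
rewrite (le_trans (ler_normB _ _)) // (le_trans (lerD h1 h2)) // /e; lra.
Qed.

End StepApproximation.

(** * Holomorphy of the smoothed steps *)

Lemma sqrt_remainder (K : fieldType) (T T' A h : K) : T' + T != 0 -> T != 0 ->
  T' - T = h * ((2 * A + h) / (T' + T)) ->
  T' - T - h * (A / T) =
  h ^+ 2 * ((T - A * ((2 * A + h) / (T' + T))) / ((T' + T) * T)).
Proof.
move=> s0 T0; set s := T' + T in s0 *; set q := (2 * A + h) / s => TT.
have sE : s = 2 * T + h * q by rewrite -TT /s; ring.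
have qs : q * s = 2 * A + h by rewrite divfK.
have E : h ^+ 2 * (T - A * q) = h * s * (q * T - A).
  have -> : h * s * (q * T - A) = h * ((q * s) * T - A * s) by ring.
  by rewrite qs sE; ring.
by rewrite [RHS]mulrA E TT; field; rewrite s0 T0.
Qed.

Lemma derivable_half_ratio (K : numFieldType) (T : K^o -> K^o) (a : K) (z : K^o) :
  derivable T z 1 -> T z != 0 ->
  derivable (fun w : K^o => (1 + (w - a) / T w) / 2 : K^o) z 1.
Proof.
move=> dT ne.
have dV : derivable (fun w : K^o => (T w)^-1 : K^o) z 1 by exact: derivableV.
have d1 : derivable ((id : K^o -> K^o) + cst (- a : K^o)) z 1.
  by apply: derivableD; [exact: derivable_id|exact: derivable_cst].
have d2 := derivableM d1 dV.
have d3 := derivableD (derivable_cst (1 : K^o) z 1) d2.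
exact: (derivableM d3 (derivable_cst (2^-1 : K^o) z 1)).
Qed.

Section Holomorphy.
Context (R : realType).

Lemma quadratic_derivable (f : R[i]^o -> R[i]^o) (z l C d : R[i]) :
  0 <= C -> 0 < d ->
  (forall h, `|h| < d -> `|f (z + h) - f z - h * l| <= C * `|h| ^+ 2) ->
  derivable f z 1.
Proof.
move=> C0 d0 H; apply/cvg_ex; exists l; apply/cvgrPdist_le => e e0.
have C1 : 0 < C + 1 by rewrite ltr_wpDl.
near=> h.
have h0 : h != 0 by near: h; exact: nbhs_dnbhs_neq.
have hd : `|h| < d by near: h; exact: dnbhs0_lt.
have he : `|h| < e / (C + 1) by near: h; apply: dnbhs0_lt; exact: divr_gt0.
rewrite /= [h *: _]mulr1 [h + z]addrC.
have -> : l - h^-1 *: (f (z + h) - f z) = - (h^-1 * (f (z + h) - f z - h * l)).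
  rewrite /GRing.scale /=; field; exact: h0.
rewrite normrN normrM normfV ler_pdivrMl ?normr_gt0 //.
rewrite (le_trans (H h hd)) // expr2 mulrA mulrC ler_wpM2l //.
rewrite (@le_trans _ _ ((C + 1) * `|h|)) //; first by rewrite ler_wpM2r // lerDl.
by rewrite mulrC -ler_pdivlMr // ltW.
Unshelve. all: by end_near. Qed.

Lemma strip_nbhs (c : R) (z : R[i]) : strip c z ->
  exists2 d : R[i], 0 < d & forall h, `|h| < d -> strip c (z + h).
Proof.
rewrite /strip /= => zc; exists (c - `|complex.Im z|)%:C; first by rewrite ltcR subr_gt0.
move=> h /(le_lt_trans (normc_ge_Im h)); rewrite ltcR => hc.
have -> : complex.Im (z + h) = complex.Im z + complex.Im h by case: z h {zc hc} => ? ? [].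
by rewrite (le_lt_trans (ler_normD _ _)) // addrC -ltrBrDr.
Qed.

Lemma strip_open (c : R) : open (strip c : set R[i]^o).
Proof.
rewrite openE => z /strip_nbhs[d d0 H]; apply/nbhs_ballP; exists d => //= w.
by rewrite /ball /= distrC => /H; rewrite addrC subrK.
Qed.

Lemma C11_derivable (c M : R) (f f' : R[i]^o -> R[i]^o) z :
  0 <= M -> C11 (strip c) M%:C f f' -> strip c z -> derivable f z 1.
Proof.
move=> M0 fC Sz; have [d d0 H] := strip_nbhs Sz; have [_ _ b3] := fC z Sz.
by apply: (quadratic_derivable (C := M%:C) _ d0) => [|h /H]; [rewrite ler0c|exact: b3].
Qed.

Lemma Re_sqrtc_ge0 (w : R[i]) : 0 <= complex.Re (sqrtc w).
Proof. by case: w => a b /=; exact: sqrtr_ge0. Qed.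

Lemma Re_sqrtc_gt0 (w : R[i]) : 0 < complex.Re w -> 0 < complex.Re (sqrtc w).
Proof.
by case: w => a b /= a0; rewrite sqrtr_gt0 divr_gt0 // ltr_wpDl //.
Qed.

(** The principal root has nonnegative real part everywhere, so [T w + T z] stays away from 0 for
    all [w]. Difference of squares then expresses the increment of [T], and a quadratic remainder
    follows without prior continuity of the root. *)
Lemma sqrtc_derivable (a : R[i]) (d : R) (z : R[i]^o) :
  0 < complex.Re (d%:C ^+ 2 + (z - a) ^+ 2) ->
  derivable (fun w : R[i]^o => sqrtc (d%:C ^+ 2 + (w - a) ^+ 2) : R[i]^o) z 1.
Proof.
pose T (w : R[i]) : R[i] := sqrtc (d%:C ^+ 2 + (w - a) ^+ 2).
move=> /Re_sqrtc_gt0; rewrite -/(T z) => r0; set r := complex.Re (T z) in r0.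
have rC0 : 0 < r%:C by rewrite ltcR.
have low w : r%:C <= `|T w + T z|.
  apply: le_trans (normc_ge_Re _); rewrite lecR (le_trans _ (ler_norm _)) //.
  have : 0 <= complex.Re (T w) by exact: Re_sqrtc_ge0.
  by rewrite /r; case: (T w) (T z) => ? ? [] ? ? /=; rewrite lerDr.
have lowz : r%:C <= `|T z|.
  by apply: le_trans (normc_ge_Re _); rewrite lecR ler_norm.
have ne w : T w + T z != 0 by rewrite -normr_gt0 (lt_le_trans rC0).
have nez : T z != 0 by rewrite -normr_gt0 (lt_le_trans rC0).
pose C : R[i] := (`|T z| + `|z - a| * (2 * `|z - a| + 1) / r%:C) / (r%:C ^+ 2).
have C0 : 0 <= C.
  by rewrite !(divr_ge0, addr_ge0, mulr_ge0, exprn_ge0) // ?(ltW rC0).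
apply: (quadratic_derivable (l := (z - a) / T z) C0 ltr01) => h h1.
rewrite -/(T (z + h)) -/(T z).
have T2 w : T w ^+ 2 = d%:C ^+ 2 + (w - a) ^+ 2 by rewrite sqr_sqrtc.
have TT : T (z + h) - T z = h * ((2 * (z - a) + h) / (T (z + h) + T z)).
  rewrite mulrA; apply: (canRL (mulfK (ne _))); rewrite -subr_sqr !T2.
  by rewrite opprD addrACA subrr add0r subr_sqr; ring.
rewrite (sqrt_remainder (ne _) nez TT) normrM normrX mulrC ler_wpM2r ?exprn_ge0 //.
have i0 : 0 <= r%:C^-1 by rewrite invr_ge0 ltW.
have inv_le w : r%:C <= `|w| -> `|w^-1| <= r%:C^-1.
  by move=> rw; rewrite normfV lef_pV2 ?posrE // (lt_le_trans rC0).
rewrite /C normrM invfM normrM expr2 invfM ler_pM // ?mulr_ge0 //; last first.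
  by rewrite ler_pM ?inv_le.
rewrite (le_trans (ler_normB _ _)) // lerD2l normrM -mulrA ler_wpM2l //.
rewrite normrM ler_pM ?inv_le //.
rewrite (le_trans (ler_normD _ _)) // normrM normr_nat lerD2l ltW //.
Qed.

Definition complex_soft_step (d t : R) (z : R[i]^o) : R[i]^o :=
  (1 + (z - t%:C) / sqrtc (d%:C ^+ 2 + (z - t%:C) ^+ 2)) / 2.

Lemma complex_soft_step_real (d t x : R) :
  complex_soft_step d t x%:C = (soft_step d (x - t))%:C.
Proof.
rewrite /complex_soft_step /soft_step -rmorphB -!rmorphXn -rmorphD.
rewrite sqrtc_sqrtr /=; last by rewrite ler0c addr_ge0 ?sqr_ge0.
by rewrite -[2](rmorph_nat (real_complex R)) -fmorph_div -[1](rmorph1 (real_complex R)) -rmorphD -fmorph_div.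
Qed.

(** On this strip the radicand has positive real part, hence stays off the branch cut of the
    root. *)
Lemma complex_soft_step_derivable (d t : R) (z : R[i]^o) : 0 < d ->
  strip (d / 2) z -> derivable (complex_soft_step d t) z 1.
Proof.
move=> d0 Sz.
have Re_gt0 : 0 < complex.Re (d%:C ^+ 2 + (z - t%:C) ^+ 2).
  case: z Sz => x y Sz; have yd : `|y| < d / 2 by exact: Sz.
  have -> : complex.Re (d%:C ^+ 2 + (x +i* y - t%:C) ^+ 2) =
      d ^+ 2 + (x - t) ^+ 2 - y ^+ 2.
    by rewrite !expr2 /=; ring.
  have : y ^+ 2 < d ^+ 2.
    rewrite -real_normK ?num_real // ltr_pXn2r ?nnegrE ?(ltW d0) //.
    by rewrite (lt_trans yd) // ltr_pdivrMr // ltr_pMr // ltr1n.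
  by have := sqr_ge0 (x - t); lra.
have ne : sqrtc (d%:C ^+ 2 + (z - t%:C) ^+ 2) != 0.
  have := Re_sqrtc_gt0 Re_gt0; apply: contraTneq => ->.
  by rewrite ltxx.
have dT := sqrtc_derivable Re_gt0.
have := @derivable_half_ratio R[i] (fun w => sqrtc (d%:C ^+ 2 + (w - t%:C) ^+ 2)) t%:C z dT ne.
exact.
Qed.

End Holomorphy.

(** * Assembly of [sigma] *)

Lemma derivable_affine_sum (K : numFieldType) (n : nat) (c0 : K) (c : 'I_n -> K)
    (f : 'I_n -> K^o -> K^o) (g : K^o -> K^o) (z : K^o) :
  (forall k, derivable (f k) z 1) -> derivable g z 1 ->
  derivable (fun w : K^o => c0 + \sum_k c k * f k w + g w : K^o) z 1.
Proof.
move=> df dg.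
have dk k : derivable (cst (c k : K^o) * f k) z 1.
  by apply: derivableM; [exact: derivable_cst|exact: df].
have ds := derivable_sum dk.
have := derivableD (derivableD (derivable_cst (c0 : K^o) z 1) ds) dg.
congr (derivable _ z 1); apply/funext => w.
rewrite /GRing.add /=; congr (_ + _ + _).
by rewrite fct_sumE.
Qed.

Lemma norm_Linfty_le (R : realType) (f : R -> R) (e : R) :
  0 <= e -> (forall x, `|f x| <= e) -> (norm_Linfty f <= e%:E)%E.
Proof.
move=> e0 fe; rewrite /norm_Linfty unlock; case: ifP => _; last by rewrite lee_fin.
by apply/ess_supP; apply: aeW => x; rewrite /= lee_fin.
Qed.

Lemma lipschitz_soft_steps (R : realType) (n : nat) (d c0 : R) (c t : 'I_n -> R) :
  0 < d -> lipschitz_fun (fun x => c0 + \sum_k c k * soft_step d (x - t k)).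
Proof.
move=> d0; exists (\sum_k `|c k| * d^-1).
  by rewrite sumr_ge0 // => k _; rewrite mulr_ge0 // invr_ge0 ltW.
move=> x y; rewrite opprD addrACA subrr add0r -sumrB mulr_suml.
rewrite (le_trans (ler_norm_sum _ _ _)) //; apply: ler_sum => k _.
rewrite -mulrBr normrM -mulrA ler_wpM2l //.
rewrite (le_trans (soft_step_lipschitz d0 _ _)) //.
by have -> : x - t k - (y - t k) = x - y by ring.
Qed.

Theorem theorem2 (R : realType) (Din : nat) (rho : R -> R) (eps : R)
    (Din_gt0 : (0 < Din)%N)
    (rhoC1 : piecewise_C1 rho)
    (rhoBV : BV_line rho^`())
    (eps_gt0 : 0 < eps) :
  exists (D P : set R[i]^o) (sigma : R[i]^o -> R[i]^o),
    let sigmaR (x : R) : R := complex.Re (sigma x%:C) in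
    [/\ meromorphic D P sigma,
        forall x : R, D x%:C /\ ~ P x%:C,
        forall x : R, sigma x%:C = (sigmaR x)%:C,
        (norm_Linfty (fun x : R => rho x - sigmaR x)%R < eps%:E)%E &
        forall (n : nat) (N : 'I_n -> nc_network R Din),
          (forall i j, i != j -> ~ isomorphic (N i) (N j)) ->
          linearly_independent
            (with_one (fun j => nc_realization sigmaR (N j)))].
Proof.
have [rhoL1 _] := rhoBV.
(* Approximation and perturbation each take [eps / 4], so the total stays strictly below [eps]. *)
have e4 : 0 < eps / 4 by rewrite divr_gt0.
have [n [d [c0 [c [t [d0 d1 Hs0]]]]]] := soft_step_approximation rhoC1 rhoL1 e4.
set s0 := fun x => c0 + \sum_k c k * soft_step d (x - t k) in Hs0.
have s0L : lipschitz_fun s0 by exact: lipschitz_soft_steps.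
have [G [G' [M [M0 GC GR Ge Ggen]]]] := generic_perturbation Din s0L e4.
pose sigma (z : R[i]^o) : R[i]^o :=
  c0%:C + \sum_k (c k)%:C * complex_soft_step d (t k) z + G z.
have d20 : 0 < d / 2 by rewrite divr_gt0.
have sigmaE (x : R) : sigma x%:C = (s0 x + complex.Re (G x%:C))%:C.
  rewrite /sigma GR /s0 !rmorphD rmorph_sum /=; congr (_ + _ + _).
  by apply: eq_bigr => k _; rewrite complex_soft_step_real -rmorphM.
have sigmaRE : (fun x : R => complex.Re (sigma x%:C)) =
    (fun x => s0 x + complex.Re (G x%:C)) by apply/funext => x; rewrite sigmaE.
(* Since [d <= 1], this strip lies inside the strip of half-width [1 / 2] on which [G] is
   controlled. *)
exists (strip (d / 2)), set0, sigma; split=> /=.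
- split=> //; first exact: strip_open.
    by move=> z _ /(_ setT filterT)[y []].
  move=> z Sz _; apply: (filterS (P := strip (d / 2))); last first.
    exact: open_nbhs_nbhs (conj (@strip_open _ _) Sz).
  move=> w Sw; apply: derivable_affine_sum => [k|].
    exact: complex_soft_step_derivable.
  apply: (C11_derivable M0 GC); apply: lt_le_trans Sw _.
  by rewrite ler_pM2r // invr_gt0.
- by move=> x; split=> //; exact: strip_real.
- by move=> x; rewrite sigmaE.
- apply: (@le_lt_trans _ _ (eps / 2)%:E); last first.
    by rewrite lte_fin ltr_pdivrMr // ltr_pMr // ltr1n.
  apply: norm_Linfty_le => [|x]; first by rewrite divr_ge0 // ltW.
  rewrite sigmaE /= opprD addrA (le_trans (ler_normB _ _)) //.
  by apply: le_trans (lerD (Hs0 x) (Ge x)) _; lra.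
move=> m N noniso; rewrite sigmaRE; apply: nc_realizations_independent => //.
have [L L0 HL] := s0L.
have half0 : 0 < 1 / 2 :> R by rewrite divr_gt0.
exists (L + 2 * M); first by rewrite addr_ge0 // mulr_ge0.
move=> x y; rewrite opprD addrACA (le_trans (ler_normD _ _)) // mulrDl lerD //.
exact: (C11_real_lipschitz (fR := fun x => complex.Re (G x%:C)) half0 M0 GC GR).
Qed.
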